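(* Let $\mathcal{H}$ be a Hilbert space, $B\in L(\mathcal{H})^s$ and let $\mathcal{S}$ be a closed subspace of $\mathcal{H}$. Then $B$ is $\mathcal{S}$-weakly complementable if and only if there exists a densely defined projection $E$ with $N(E)=\mathcal{S}^{\perp}$ such that $E\,|P_{\mathcal{S}}BP_{\mathcal{S}}|^{1/2}\in L(\mathcal{H})$ and $EB\in L(\mathcal{H})^s$. In this case, for any such $E$, $$B_{/\mathcal{S}}=(I-E)B.$$
   Context: Hilbert spaces are complex and separable. $L(\mathcal{H})$ is the algebra of bounded (everywhere defined) operators on $\mathcal{H}$, $L(\mathcal{H})^s$ the set of selfadjoint ones. $R(\cdot)$, $N(\cdot)$ denote range and nullspace, $|T|=(T^*T)^{1/2}$, and $P_{\mathcal{S}}$ is the orthogonal projection onto $\mathcal{S}$. A densely defined projection is a (not necessarily bounded) linear operator $E:\mathrm{Dom}(E)\subseteq\mathcal{H}\to\mathcal{H}$ with dense domain, $R(E)\subseteq \mathrm{Dom}(E)$ and $E^2=E$. The statement $ET\in L(\mathcal{H})$ (for $T\in L(\mathcal{H})$) includes that $R(T)\subseteq\mathrm{Dom}(E)$. Write $B=\begin{pmatrix} a & b\\ b^* & c\end{pmatrix}$ with respect to $\mathcal{H}=\mathcal{S}\oplus\mathcal{S}^\perp$. $B$ is $\mathcal{S}$-weakly complementable if $R(b)\subseteq R(|a|^{1/2})$. In that case let $f\in L(\mathcal{S}^\perp,\mathcal{S})$ be the reduced solution of $b=|a|^{1/2}x$, i.e. the unique $f$ with $b=|a|^{1/2}f$,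 $N(f)=N(b)$ and $R(f)\subseteq\overline{R(|a|^{1/2})}$, and let $a=u|a|$ be the polar decomposition ($u$ a partial isometry with $N(u)=N(a)$). The Schur complement of $B$ to $\mathcal{S}$ is $B_{/\mathcal{S}}:=\begin{pmatrix}0&0\\0&c-f^*uf\end{pmatrix}$. *)

(* Defs.v *)
From HB Require Import structures.
From mathcomp Require Import all_boot all_order all_algebra.
From mathcomp Require Import sesquilinear complex.
From mathcomp Require Import boolp classical_sets functions cardinality reals.
From mathcomp Require Import topology normedtype.

Set Implicit Arguments.
Unset Strict Implicit.
Unset Printing Implicit Defensive.

Import Order.TTheory GRing.Theory Num.Theory.

Local Open Scope classical_set_scope.
Local Open Scope ring_scope.
Local Open Scope complex_scope.

(* Complex Hilbert spaces over C = R[i].  The inner product is linear in its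
   first argument and conjugate-linear in the second. *)
HB.mixin Record NormedModule_isHilbert (R : realType) (H : Type)
    of CompleteNormedModule R[i] H := {
  hdot : {dot H for (@Num.conj R[i])} ;
  hdot_norm : forall x : H, hdot x x = `|x| ^+ 2
}.

#[short(type="hilbertType")]
HB.structure Definition Hilbert (R : realType) :=
  {H of CompleteNormedModule R[i] H & NormedModule_isHilbert R H}.

Notation "''<[' x , y ]>" := (hdot x y)
  (at level 0, format "''<[' x ,  y ]>") : ring_scope.

Definition separable (T : topologicalType) : Prop :=
  exists2 D : set T, countable D & dense D.

Section Operators.
Context {R : realType} {H : hilbertType R}.
Implicit Types (S : set H) (T A B u f : H -> H) (x y z : H).

Definition subspace S : Prop :=
  S 0 /\ forall (k : R[i]) x y, S x -> S y -> S (k *: x + y).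

Definition closed_subspace S : Prop := subspace S /\ closed S.

Definition orthocomp S : set H := [set x | forall y, S y -> '<[x, y]> = 0].

Definition proj S x : H := xget 0 [set y | S y /\ orthocomp S (x - y)].

(* L(H) *)
Definition bounded_op : set (H -> H) :=
  [set T | linear T /\ exists M : R, forall x, `|T x| <= M%:C * `|x|].

Definition nullspace T : set H := [set x | T x = 0].

Definition adjoint T : H -> H :=
  xget (fun=> 0)
    [set T' | bounded_op T' /\ forall x y, '<[T x, y]> = '<[x, T' y]>].

(* L(H)^s *)
Definition selfadjoint_op : set (H -> H) :=
  [set T | bounded_op T /\ adjoint T = T].

(* The order of R[i] is partial: 0 <= z entails that z is real. *)
Definition positive_op : set (H -> H) :=
  [set T | bounded_op T /\ forall x, 0 <= '<[T x, x]>].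

Definition sqrt_op A : H -> H :=
  xget (fun=> 0) [set X | positive_op X /\ X \o X = A].

Definition modulus T : H -> H := sqrt_op (adjoint T \o T).

Definition partial_isometry u : Prop :=
  bounded_op u /\ forall x, orthocomp (nullspace u) x -> `|u x| = `|x|.

(* The partial isometry of the polar decomposition of T. *)
Definition polar T : H -> H :=
  xget (fun=> 0)
    [set u | [/\ partial_isometry u, nullspace u = nullspace T
              & T = u \o modulus T]].

Definition reduced_solution A T : H -> H :=
  xget (fun=> 0)
    [set f | [/\ bounded_op f, T = A \o f, nullspace f = nullspace T
              & range f `<=` closure (range A)]].

(* For closed subspaces U and V, an operator in L(U, V) is represented by its
   extension by 0 on the orthogonal complement of U, viewed as an operator on
   H.  The extension does not change ranges, adds the complement of U to
   nullspaces, and commutes with sums, products, adjoints and positive square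
   roots; so the modulus, polar decomposition and reduced solution of the
   extensions are the extensions of those of the entries. *)
Definition block (U V : set H) B : H -> H := proj V \o B \o proj U.

Definition entry_a S B := block S S B.
Definition entry_b S B := block (orthocomp S) S B.
Definition entry_c S B := block (orthocomp S) (orthocomp S) B.

Definition weakly_complementable S B : Prop :=
  range (entry_b S B) `<=` range (sqrt_op (modulus (entry_a S B))).

(* The value is meaningful when B is selfadjoint and weakly complementable.
   The only nonzero entry of the Schur complement lies in
   L(orthocomp S, orthocomp S). *)
Definition schur_complement S B : H -> H :=
  let f := reduced_solution (sqrt_op (modulus (entry_a S B))) (entry_b S B) in
  let u := polar (entry_a S B) in
  entry_c S B \- (adjoint f \o u \o f).

End Operators.

(* A not necessarily everywhere defined operator; the values of pfun outside
   pdom are irrelevant. *)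
Record partial_op (R : realType) (H : hilbertType R) := PartialOp {
  pdom : set H ;
  pfun :> H -> H ;
  pdom_subspace : subspace pdom ;
  pfun_linear : forall (k : R[i]) (x y : H), pdom x -> pdom y ->
    pfun (k *: x + y) = k *: pfun x + pfun y
}.

Section DenselyDefinedProjections.
Context {R : realType} {H : hilbertType R}.
Implicit Types (E : partial_op H) (T : H -> H).

Definition densely_defined_projection E : Prop :=
  [/\ dense (pdom E),
      E @` pdom E `<=` pdom E
    & forall x, pdom E x -> E (E x) = E x].

Definition pnullspace E : set H := [set x | pdom E x /\ E x = 0].

(* "E T belongs to X", where X is a set of everywhere defined operators. *)
Definition pcomp_in E T (X : set (H -> H)) : Prop :=
  range T `<=` pdom E /\ X (E \o T).

End DenselyDefinedProjections.

(* Main.v *)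
(** Put [a = PBP], [r = |a|^(1/2)] and let [u] be the partial isometry of
    [a = u|a|].  Then [u] is selfadjoint, commutes with [r], satisfies
    [u u r = r], and [a = r u r].

    If [b = r f] with [f] the reduced solution, the projection is
    [E z = P z + f^* u y] for [z = r y + n] in [R(r) + N(r)], which is dense and
    contains [R(B)].  It satisfies [E r = r + f^* u], and [u u r = r] and
    [f^* r = b^*] give [E B = P B + B P - P B P + f^* u f].

    Conversely, let [E] be admissible and [T = E r].  Since [P E = P] on
    [Dom E], taking adjoints in [P (E B) = P B] gives [E B P = B P]; together
    with [E = E P] this yields [B P = E a = T u r].  The adjoint of this
    identity factors [b] through [r], and comparing it with [f^* r = b^*] gives
    [f^* = (T - r) u], hence [f^* u f = (T - r) f = E b - b]. *)

Require Import Defs.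
From HB Require Import structures.
From mathcomp Require Import all_boot all_order all_algebra.
From mathcomp Require Import sesquilinear complex.
From mathcomp Require Import boolp classical_sets functions cardinality reals.
From mathcomp Require Import topology normedtype.
From mathcomp Require Import ring lra.
(* [topology] shadows [Defs.subspace]. *)
Import Defs.

Set Implicit Arguments.
Unset Strict Implicit.
Unset Printing Implicit Defensive.

Import Order.TTheory GRing.Theory Num.Theory.

Local Open Scope classical_set_scope.
Local Open Scope ring_scope.
Local Open Scope complex_scope.

(** * Inner products and limits *)

(** The range of [r] need not be closed, so [E], which inverts [r] on [R(r)], is unbounded in
    general. Adjoints are therefore taken of [T = E r] and of [E B], never of [E]; this is where the
    two boundedness conditions enter.

    The form of [E] is forced. Since [N(E)] is the orthogonal complement of [S], the operator
    [E - I] maps [S] (where defined) into that complement; call it [x]. Selfadjointness of [E B]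
    gives [x a = b^*], that is [x r u r = f^* r], and [u u r = r] suggests [x r = f^* u].

    Adjoints, square roots, polar isometries and reduced solutions are all [xget] values with
    default zero, so each is usable only after an existence proof. Square roots are built together
    with their commutation with everything that commutes with the given operator; uniqueness and the
    relations between [a], [|a|], [r] and [u] come from there. Identities between bounded operators
    are checked on [R(X)] and [N(X)] for a suitable selfadjoint [X]. *)

Section InnerProduct.
Context {R : realType} {H : hilbertType R}.
Implicit Types (x y z : H) (t : R) (k : R[i]).

Lemma cnormE k : `|k| = (complex.Re `|k|)%:C.
Proof. by rewrite RRe_real // normr_real. Qed.

Lemma cnorm_ge0 k : 0 <= complex.Re `|k|.
Proof. by rewrite -lecR -cnormE normr_ge0. Qed.

(** The norm takes values in [R[i]], whose order is only partial; its real part lives in [R], where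
    [lra] and [nra] apply. *)
Definition nm x : R := complex.Re `|x|.

Lemma normE x : `|x| = (nm x)%:C.
Proof. by rewrite /nm RRe_real // normr_real. Qed.

Lemma nm_ge0 x : 0 <= nm x.
Proof. by rewrite -lecR -normE normr_ge0. Qed.

Lemma nm0 : nm 0 = 0.
Proof. by rewrite /nm normr0. Qed.

Lemma nm0_eq0 x : nm x = 0 -> x = 0.
Proof. by move=> x0; apply/normr0_eq0; rewrite normE x0. Qed.

Lemma nmN x : nm (- x) = nm x.
Proof. by rewrite /nm normrN. Qed.

Lemma nmBC x y : nm (x - y) = nm (y - x).
Proof. by rewrite -nmN opprB. Qed.

Lemma nmD x y : nm (x + y) <= nm x + nm y.
Proof. by rewrite -lecR rmorphD /= -!normE ler_normD. Qed.

Lemma nmB_trans y x z : nm (x - z) <= nm (x - y) + nm (y - z).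
Proof. by rewrite (le_trans _ (nmD _ _)) // addrA subrK. Qed.

Lemma nmZ k x : nm (k *: x) = complex.Re `|k| * nm x.
Proof.
by apply: complexI; rewrite rmorphM /= -!normE normrZ.
Qed.

Lemma nmZr t x : nm (t%:C *: x) = `|t| * nm x.
Proof. by rewrite nmZ normc_def /= expr0n addr0 sqrtr_sqr. Qed.

Lemma dotC x y : '<[x, y]> = Num.conj '<[y, x]>.
Proof. by rewrite hermC mul1r. Qed.

Lemma dotDl x y z : '<[x + y, z]> = '<[x, z]> + '<[y, z]>.
Proof. exact: linearDl. Qed.

Lemma dotDr x y z : '<[x, y + z]> = '<[x, y]> + '<[x, z]>.
Proof. exact: linearDr. Qed.

Lemma dotBl x y z : '<[x - y, z]> = '<[x, z]> - '<[y, z]>.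
Proof. exact: linearBl. Qed.

Lemma dotBr x y z : '<[x, y - z]> = '<[x, y]> - '<[x, z]>.
Proof. exact: linearBr. Qed.

Lemma dotZl k x y : '<[k *: x, y]> = k * '<[x, y]>.
Proof. exact: linearZl_LR. Qed.

Lemma dotZr k x y : '<[x, k *: y]> = Num.conj k * '<[x, y]>.
Proof. exact: linearZr_LR. Qed.

Lemma dot0l x : '<[0, x]> = 0.
Proof. exact: linear0l. Qed.

Lemma dot0r x : '<[x, 0]> = 0.
Proof. exact: linear0r. Qed.

Lemma dotNl x y : '<[- x, y]> = - '<[x, y]>.
Proof. exact: linearNl. Qed.

Lemma dotNr x y : '<[x, - y]> = - '<[x, y]>.
Proof. exact: linearNr. Qed.

Lemma dotxx x : '<[x, x]> = (nm x ^+ 2)%:C.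
Proof. by rewrite hdot_norm normE rmorphXn. Qed.

Lemma Re_dotC x y : complex.Re '<[x, y]> = complex.Re '<[y, x]>.
Proof. by rewrite dotC; case: '<[y, x]>. Qed.

Lemma Im_dotC x y : complex.Im '<[x, y]> = - complex.Im '<[y, x]>.
Proof. by rewrite dotC; case: '<[y, x]>. Qed.

Lemma dot_eq0C x y : '<[x, y]> = 0 -> '<[y, x]> = 0.
Proof. by move=> xy0; rewrite dotC xy0 rmorph0. Qed.

Lemma Re_add (z w : R[i]) : complex.Re (z + w) = complex.Re z + complex.Re w.
Proof. by case: z; case: w. Qed.

Lemma Re_opp (z : R[i]) : complex.Re (- z) = - complex.Re z.
Proof. by case: z. Qed.

Lemma Re_realM t (z : R[i]) : complex.Re (t%:C * z) = t * complex.Re z.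
Proof. by case: z => a b /=; rewrite mul0r subr0. Qed.

Lemma conj_real t : Num.conj (t%:C : R[i]) = t%:C.
Proof. by rewrite -[LHS]/(conjc t%:C) conjc_real. Qed.

Lemma nm_sqD x y :
  nm (x + y) ^+ 2 = nm x ^+ 2 + nm y ^+ 2 + 2 * complex.Re '<[x, y]>.
Proof.
apply: (@etrans _ _ (complex.Re '<[x + y, x + y]>)); first by rewrite dotxx.
rewrite dotDl !dotDr !Re_add (Re_dotC y x) !dotxx /=; ring.
Qed.

Lemma nm_sqB x y :
  nm (x - y) ^+ 2 = nm x ^+ 2 + nm y ^+ 2 - 2 * complex.Re '<[x, y]>.
Proof. by rewrite nm_sqD nmN dotNr Re_opp mulrN. Qed.

Lemma Re_dotZr t x y : complex.Re '<[x, t%:C *: y]> = t * complex.Re '<[x, y]>.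
Proof. by rewrite dotZr conj_real Re_realM. Qed.

(** Expand the squared norm of [nm y *: x - nm x *: y] and divide by [nm x * nm y]. *)
Lemma Re_dot_le x y : complex.Re '<[x, y]> <= nm x * nm y.
Proof.
have [y0|y0] := eqVneq (nm y) 0.
  by rewrite (nm0_eq0 y0) dot0r nm0 mulr0.
have yp : 0 < nm y by rewrite lt_def y0 nm_ge0.
have := sqr_ge0 (nm ((nm y)%:C *: x - (nm x)%:C *: y)).
rewrite nm_sqB Re_dotZr dotZl Re_realM !nmZr !ger0_norm ?nm_ge0 //.
set c := complex.Re _ => h.
have [x0|x0] := eqVneq (nm x) 0.
  by rewrite /c (nm0_eq0 x0) dot0l nm0 mul0r.
have xp : 0 < nm x by rewrite lt_def x0 nm_ge0.
have pp : 0 < nm x * nm y by rewrite mulr_gt0.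
rewrite -(ler_pM2l pp); nra.
Qed.

(** Multiplying [x] by the conjugate of [w = '<[x, y]>] turns the inner product into the real number
    [|w|^2], to which the real version applies. *)
Lemma dot_le x y : complex.Re `|'<[x, y]>| <= nm x * nm y.
Proof.
set w := '<[x, y]>; set n := complex.Re `|w|.
have nE : `|w| = n%:C := cnormE w.
have [n0|n0] := eqVneq n 0; first by rewrite n0 mulr_ge0 ?nm_ge0.
have np : 0 < n by rewrite lt_def n0 cnorm_ge0.
have := Re_dot_le (Num.conj w *: x) y.
rewrite dotZl -/w mulrC -normCK nE nmZ norm_conjC nE /=.
by rewrite mul0r subr0 -mulrA (ler_pM2l np).
Qed.

Lemma dot_eq_l x y : (forall z, '<[x, z]> = '<[y, z]>) -> x = y.
Proof.
move=> xy; apply/eqP; rewrite -subr_eq0; apply/eqP/nm0_eq0/eqP.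
rewrite -sqrf_eq0; apply/eqP/complexI.
by rewrite -dotxx dotBl xy subrr.
Qed.

Lemma dot_eq_r x y : (forall z, '<[z, x]> = '<[z, y]>) -> x = y.
Proof. by move=> xy; apply: dot_eq_l => z; rewrite dotC xy -dotC. Qed.

Lemma dot_self_eq0 x : '<[x, x]> = 0 -> x = 0.
Proof.
rewrite dotxx => /complexI/eqP; rewrite sqrf_eq0 => /eqP; exact: nm0_eq0.
Qed.

End InnerProduct.

(** * Limits with explicit rates, closures and density *)

Section Completeness.
Context {R : realType} {H : hilbertType R}.
Implicit Types (x y z : H) (A : set H).

Lemma inv_succ_lt (c e : R) : 0 < e -> exists N : nat, forall n, (N <= n)%N ->
  c / n.+1%:R < e.
Proof.
move=> e0; exists (Num.truncn (`|c| / e)) => n Nn.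
rewrite ltr_pdivrMr ?ltr0n // mulrC -ltr_pdivrMr //.
apply: le_lt_trans (_ : `|c| / e < _).
  by rewrite ler_pM2r ?invr_gt0 // ler_norm.
by apply: lt_le_trans (truncnS_gt _) _; rewrite ler_nat.
Qed.

(** The limit keeps the Cauchy rate [d], so later limit passages become estimates of the form
    [c / n.+1] instead of filter arguments. *)
Lemma complete_rate (u : nat -> H) (d : nat -> R) :
  (forall e, 0 < e -> exists N : nat, forall n, (N <= n)%N -> d n < e) ->
  (forall n m, (n <= m)%N -> nm (u m - u n) <= d n) ->
  exists l, forall n, nm (u n - l) <= d n.
Proof.
move=> d0 ud.
have cu : cvg (u @ \oo).
  apply: cauchy_cvg; apply: cauchy_exP => eps eps0.
  have ep : 0 < complex.Re eps by move: eps0; rewrite ltcE => /andP[].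
  have eE : eps = (complex.Re eps)%:C by rewrite RRe_real // gtr0_real.
  have [N dN] := d0 _ ep; exists (u N); exists N => // n /= Nn.
  rewrite -ball_normE /ball_ /= normE eE ltcR nmBC.
  by apply: le_lt_trans (ud _ _ Nn) (dN _ _).
exists (lim (u @ \oo)) => n.
apply/ler_addgt0Pr => e e0.
have eC0 : 0 < (e%:C : R[i]) by rewrite ltcR.
have /cvgrPdist_lt /(_ _ eC0)[N _ uN] := cu.
have /= := uN (maxn N n) (leq_maxl _ _).
rewrite normE ltcR => um.
apply: le_trans (nmB_trans (u (maxn N n)) _ _) _.
rewrite (nmBC _ (lim _)) (nmBC (u n)); apply: lerD (ltW um).
by apply: ud; apply: leq_maxr.
Qed.

Lemma ball_nm x (e : R) : ball x e%:C = [set y | nm (x - y) < e].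
Proof.
by rewrite -ball_normE; apply/seteqP; split => y; rewrite /ball_ /= normE ltcR.
Qed.

Lemma nbhs_nm x A : nbhs x A <-> exists2 e : R, 0 < e &
  forall y, nm (x - y) < e -> A y.
Proof.
split.
  move=> /nbhs_ballP[eps /= eps0 xA].
  have ep : 0 < complex.Re eps by move: eps0; rewrite ltcE => /andP[].
  have eE : eps = (complex.Re eps)%:C by rewrite RRe_real // gtr0_real.
  exists (complex.Re eps) => // y xy; apply: xA; by rewrite eE ball_nm.
move=> [e e0 xA]; apply/nbhs_ballP; exists e%:C => /=; first by rewrite ltcR.
by rewrite ball_nm.
Qed.

Lemma closureP A x : closure A x <-> forall e : R, 0 < e ->
  exists2 y, A y & nm (x - y) < e.
Proof.
split.
  move=> Ax e e0.
  have /Ax[y [Ay xy]] : nbhs x [set y | nm (x - y) < e].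
    by apply/nbhs_nm; exists e.
  by exists y.
move=> xA B /nbhs_nm[e e0 xB]; have [y Ay xy] := xA _ e0.
by exists y; split => //; apply: xB.
Qed.

Lemma denseP A : dense A <-> forall x, closure A x.
Proof.
split.
  move=> dA x B /nbhs_nm[e e0 xB].
  have := dA (interior [set y | nm (x - y) < e]).
  case.
  - exists x; apply/nbhs_nm; by exists e.
  - exact: open_interior.
  - move=> y [/interior_subset xy Ay]; exists y; split => //; exact: xB.
move=> cA O [x Ox] Oo.
have [y [Ay Oy]] := cA x O (open_nbhs_nbhs (conj Oo Ox)).
by exists y.
Qed.

End Completeness.

(** * Orthogonal projections *)

Section Projection.
Context {R : realType} {H : hilbertType R}.
Implicit Types (x y z : H) (S : set H).

Lemma subspaceD S x y : subspace S -> S x -> S y -> S (x + y).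
Proof. by move=> [_ lS] Sx Sy; rewrite -[x]scale1r; apply: lS. Qed.

Lemma subspaceZ S (k : R[i]) x : subspace S -> S x -> S (k *: x).
Proof. by move=> [S0 lS] Sx; rewrite -[_ *: _]addr0; apply: lS. Qed.

Lemma subspaceB S x y : subspace S -> S x -> S y -> S (x - y).
Proof. by move=> [_ lS] Sx Sy; rewrite addrC -scaleN1r; apply: lS. Qed.

Lemma closure_subspace S : subspace S -> closed_subspace (closure S).
Proof.
move=> sS; split; last exact: closed_closure.
split; first by apply: subset_closure; case: sS.
move=> k x y /closureP Sx /closureP Sy; apply/closureP => e e0.
set c := complex.Re `|k|.
have c0 : 0 <= c := cnorm_ge0 k.
have e1 : 0 < e / 2 by rewrite divr_gt0.
have e2 : 0 < e / (2 * (c + 1)) by rewrite divr_gt0 // mulr_gt0 //; lra.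
have [x' Sx' xx'] := Sx _ e2; have [y' Sy' yy'] := Sy _ e1.
exists (k *: x' + y'); first by apply: subspaceD => //; apply: subspaceZ.
rewrite opprD addrACA -scalerBr; apply: le_lt_trans (nmD _ _) _.
rewrite nmZ -/c.
have : c * nm (x - x') <= e / 2; last by move=> ?; lra.
have -> : e / 2 = (c + 1) * (e / (2 * (c + 1))) by field; lra.
by apply: ler_pM; rewrite ?nm_ge0 //; [lra | exact: ltW].
Qed.

Lemma orthocomp_closure S x : orthocomp S x -> orthocomp (closure S) x.
Proof.
move=> Sx y /closureP Sy.
have small (e : R) : 0 < e -> complex.Re `|'<[x, y]>| <= e.
  move=> e0; have e1 : 0 < e / (nm x + 1).
    by rewrite divr_gt0 // ltr_wpDl ?nm_ge0.
  have [z /Sx xz yz] := Sy _ e1.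
  rewrite -[y](subrK z) dotDr xz addr0; apply: le_trans (dot_le _ _) _.
  have x0 := nm_ge0 x.
  have -> : e = (nm x + 1) * (e / (nm x + 1)) by field; lra.
  by apply: ler_pM; rewrite ?nm_ge0 //; [lra | exact: ltW].
apply/normr0_eq0; rewrite cnormE; congr (_%:C).
apply/eqP; rewrite eq_le cnorm_ge0 andbT.
by apply/ler_addgt0Pl => e /small; rewrite addr0.
Qed.

Lemma orthocomp_closed_subspace S : closed_subspace (orthocomp S).
Proof.
have sub : subspace (orthocomp S).
  split=> [y _|k x y Sx Sy z Sz]; first by rewrite dot0l.
  by rewrite dotDl dotZl Sx // Sy // mulr0 addr0.
split=> //; apply/closure_id/seteqP; split=> [|x clx y Sy].
  exact: subset_closure.
apply/dot_eq0C; apply: (@orthocomp_closure (orthocomp S)) clx.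
by move=> z /(_ y Sy) /dot_eq0C.
Qed.

(** Compare [x] with [x - t w s], where [w = '<[x, s]>]: minimality gives
    [2 t |w|^2 <= t^2 |w|^2 |s|^2]. The choice [t = 1 / (|s|^2 + 1)] keeps [t |s|^2 <= 1] and also
    covers [s = 0]. *)
Lemma orthocomp_of_min S x : subspace S ->
  (forall s, S s -> nm x <= nm (x - s)) -> orthocomp S x.
Proof.
move=> sS xmin s Ss; set w := '<[x, s]>; set n := complex.Re `|w|.
have nE : `|w| = n%:C := cnormE w.
have n0 : 0 <= n := cnorm_ge0 w.
set t := (nm s ^+ 2 + 1)^-1.
have s0 := sqr_ge0 (nm s).
have t0 : 0 < t by rewrite invr_gt0; lra.
have := xmin _ (subspaceZ (t%:C * w) sS Ss).
have -> : (t%:C * w) *: s = t%:C *: (w *: s) by rewrite scalerA.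
rewrite -ler_sqr ?nnegrE ?nm_ge0 // nm_sqB nmZr nmZ (gtr0_norm t0) Re_dotZr.
rewrite dotZr -/w (mulrC _ w) -normCK nE -rmorphXn /=.
move=> h.
have ts : t * nm s ^+ 2 <= 1 by rewrite /t mulrC ler_pdivrMr; lra.
have : 2 * (t * n ^+ 2) <= t * n ^+ 2 * (t * nm s ^+ 2).
  move: h; set a := nm x ^+ 2; nra.
have tn : 0 <= t * n ^+ 2 by rewrite mulr_ge0 ?sqr_ge0 // ltW.
move=> h2; have : t * n ^+ 2 = 0 by nra.
move=> /eqP; rewrite mulf_eq0 (gt_eqF t0) /= sqrf_eq0 => /eqP n00.
by apply/normr0_eq0; rewrite nE n00.
Qed.

Lemma projection_exists S x : closed_subspace S ->
  exists y, S y /\ orthocomp S (x - y).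
Proof.
move=> [sS cS]; have [S0 _] := sS.
pose D := [set nm (x - s) | s in S].
have infD : has_inf D.
  by split; [exists (nm (x - 0)); exists 0 | exists 0 => _ [s _ <-]; exact: nm_ge0].
set i := inf D.
have ile s : S s -> i <= nm (x - s).
  by move=> Ss; apply: ge_inf; [case: infD | exists s].
have i0 : 0 <= i by apply: lb_le_inf; [case: infD|move=> _ [s _ <-]; exact: nm_ge0].
have /choice[u uP] : forall n : nat, exists s, S s /\ nm (x - s) < i + n.+1%:R^-1.
  move=> n; have n0 : (0 : R) < n.+1%:R^-1 by rewrite invr_gt0 ltr0n.
  by have [_ [s Ss <-] ltx] := inf_adherent n0 infD; exists s.
(* From [nm (x - u n) < i + a] with [a = 1 / n.+1 <= 1], the square is at most [i^2 + (2 i + 1) a].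
   The parallelogram law, with the midpoint at distance at least [i] from [x], then bounds
   [nm (u m - u n) ^+ 2] by [4 (2 i + 1) a]. *)
pose c := 4 * (2 * i + 1).
have c0 : 0 <= c by rewrite /c; lra.
pose d (n : nat) := Num.sqrt (c / n.+1%:R).
have sqd n : d n ^+ 2 = c / n.+1%:R by rewrite sqr_sqrtr // divr_ge0 // ler0n.
have dlim e : 0 < e -> exists N : nat, forall n, (N <= n)%N -> d n < e.
  move=> e0; have [N NP] := inv_succ_lt c (exprn_gt0 2 e0).
  exists N => n /NP; rewrite -sqd ltr_sqr ?nnegrE ?sqrtr_ge0 //; exact: ltW.
have ud n m : (n <= m)%N -> nm (u m - u n) <= d n.
  move=> nm_; rewrite -ler_sqr ?nnegrE ?sqrtr_ge0 ?nm_ge0 // sqd.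
  have [Sn xn] := uP n; have [Sm xm] := uP m.
  have Smid : S ((2^-1)%:C *: (u n + u m)).
    by apply: subspaceZ => //; apply: subspaceD.
  have : i ^+ 2 <= nm (x - (2^-1)%:C *: (u n + u m)) ^+ 2.
    by rewrite ler_sqr ?nnegrE ?nm_ge0 //; apply: ile.
  have e1 : (x - u n) + (x - u m) = (2%:R)%:C *: (x - (2^-1)%:C *: (u n + u m)).
    rewrite scalerBr scalerA -rmorphM /= divff ?pnatr_eq0 // scale1r.
    by rewrite rmorphMn /= scaler_nat mulr2n addrACA opprD.
  have e2 : (x - u n) - (x - u m) = u m - u n.
    by rewrite opprB addrC addrA subrK.
  have := nm_sqD (x - u n) (x - u m); rewrite e1 nmZr ger0_norm ?ler0n //.
  have := nm_sqB (x - u n) (x - u m); rewrite e2.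
  have n0 : (0 : R) < n.+1%:R^-1 by rewrite invr_gt0 ltr0n.
  have m0 : (0 : R) < m.+1%:R^-1 by rewrite invr_gt0 ltr0n.
  have mn : m.+1%:R^-1 <= n.+1%:R^-1 :> R.
    by rewrite lef_pV2 ?posrE ?ltr0n // ler_nat.
  have n1 : n.+1%:R^-1 <= 1 :> R by rewrite invf_le1 ?ltr0n // ler1n.
  have Xn := nm_ge0 (x - u n); have Xm := nm_ge0 (x - u m).
  rewrite /c; move: xn xm n0 m0 mn n1 Xn Xm.
  move: (nm (x - u n)) (nm (x - u m)) (nm (u m - u n)) (nm (x - _ *: _)).
  move: (n.+1%:R^-1) (m.+1%:R^-1) (complex.Re _) => a b r X Y Z W.
  move=> Xa Yb a0 b0 ba a1 X0 Y0 h1 h2 h3.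
  have hX : X ^+ 2 <= i ^+ 2 + (2 * i + 1) * a by nra.
  have hY : Y ^+ 2 <= i ^+ 2 + (2 * i + 1) * b by nra.
  have hb : (2 * i + 1) * b <= (2 * i + 1) * a by rewrite ler_wpM2l //; lra.
  lra.
have [l lP] := complete_rate dlim ud.
have Sl : S l.
  rewrite (closure_id S).1 //; apply/closureP => e /dlim[N dN].
  exists (u N); first by have [] := uP N.
  by rewrite nmBC; apply: le_lt_trans (lP _) (dN _ _).
exists l; split=> //; apply: orthocomp_of_min => // s Ss.
rewrite -addrA -opprD; apply: le_trans (ile _ (subspaceD sS Sl Ss)).
apply/ler_addgt0Pr => e e0; have e1 : 0 < e / 2 by rewrite divr_gt0.
have [N1 h1] := dlim _ e1; have [N2 h2] := inv_succ_lt 1 e1.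
have := h1 (maxn N1 N2) (leq_maxl _ _); have := h2 (maxn N1 N2) (leq_maxr _ _).
move: (maxn _ _) => n; rewrite mul1r; have [_] := uP n; have := lP n.
have := nmB_trans (u n) x l.
by move: (nm (x - l)) (nm (u n - l)) (n.+1%:R^-1) => A B C; lra.
Qed.

Lemma projP S x : closed_subspace S -> S (proj S x) /\ orthocomp S (x - proj S x).
Proof.
move=> /(projection_exists x).
exact: (@xgetPex _ 0 [set y | S y /\ orthocomp S (x - y)]).
Qed.

Lemma proj_eq S x y : subspace S -> S y -> orthocomp S (x - y) -> proj S x = y.
Proof.
move=> sS Sy xy.
have [Sp xp] : S (proj S x) /\ orthocomp S (x - proj S x).
  apply: (@xgetPex _ 0 [set y | S y /\ orthocomp S (x - y)]).
  by exists y.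
have Sd := subspaceB sS Sp Sy.
apply/eqP; rewrite -subr_eq0; apply/eqP/dot_self_eq0.
have {1}-> : proj S x - y = (x - y) - (x - proj S x) by rewrite opprB [RHS]addrC addrA subrK.
by rewrite dotBl xy // xp // subrr.
Qed.

Lemma proj_orthocomp S x : closed_subspace S ->
  proj (orthocomp S) x = x - proj S x.
Proof.
move=> cS; have [Sp xp] := projP x cS.
apply: proj_eq => //; first by case: (orthocomp_closed_subspace S).
by rewrite opprB addrC subrK => y Sy; apply/dot_eq0C/Sy.
Qed.

Lemma proj_id S x : subspace S -> S x -> proj S x = x.
Proof.
by move=> sS Sx; apply: proj_eq => //; rewrite subrr => y _; rewrite dot0l.
Qed.

Lemma proj_eq0 S x : subspace S -> orthocomp S x -> proj S x = 0.
Proof.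
by move=> sS Sx; apply: proj_eq => //; [case: sS | rewrite subr0].
Qed.

Lemma orthocompK S x : closed_subspace S -> orthocomp (orthocomp S) x -> S x.
Proof.
move=> cS oox; have [Sp xp] := projP x cS.
suff -> : x = proj S x by [].
apply/eqP; rewrite -subr_eq0; apply/eqP/dot_self_eq0.
rewrite {1}dotBl oox // sub0r; apply/eqP; rewrite oppr_eq0; apply/eqP.
exact/dot_eq0C/xp.
Qed.

Lemma closure_orthocomp S x : subspace S -> orthocomp (orthocomp S) x -> closure S x.
Proof.
move=> /closure_subspace cS oox; apply: (orthocompK cS) => y Sy; apply: oox => z Sz.
by apply: Sy; apply: subset_closure.
Qed.

Lemma proj_dot S x y : closed_subspace S -> '<[proj S x, y]> = '<[x, proj S y]>.
Proof.
move=> cS; have [Sx xp] := projP x cS; have [Sy yp] := projP y cS.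
have /eqP := xp _ Sy; rewrite dotBl subr_eq0 => /eqP ->.
have /eqP := yp _ Sx; rewrite dotBl subr_eq0 => /eqP /(congr1 Num.conj).
by rewrite -!dotC.
Qed.

End Projection.

(** * Bounded operators and adjoints *)

Section BoundedOperators.
Context {R : realType} {H : hilbertType R}.
Implicit Types (x y z : H) (S : set H) (T A B : H -> H) (k : R[i]).

Lemma linD T x y : linear T -> T (x + y) = T x + T y.
Proof. by move=> lT; rewrite -{1}[x]scale1r lT scale1r. Qed.

Lemma lin0 T : linear T -> T 0 = 0.
Proof. by move=> lT; apply: (addrI (T 0)); rewrite -linD // !addr0. Qed.

Lemma linZ T k x : linear T -> T (k *: x) = k *: T x.
Proof. by move=> lT; rewrite -[k *: x]addr0 lT lin0 // addr0. Qed.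

Lemma linB T x y : linear T -> T (x - y) = T x - T y.
Proof. by move=> lT; rewrite addrC -scaleN1r lT scaleN1r addrC. Qed.

Lemma boundedP T : bounded_op T <->
  linear T /\ exists2 M : R, 0 < M & forall x, nm (T x) <= M * nm x.
Proof.
split=> [[lT [M TM]]|[lT [M M0 TM]]]; split=> //.
  exists (`|M| + 1) => [|x]; first by rewrite ltr_wpDl.
  have := TM x; rewrite !normE -rmorphM lecR => /le_trans; apply.
  by rewrite ler_wpM2r ?nm_ge0 // ler_wpDr // ler_norm.
by exists M => x; rewrite !normE -rmorphM lecR.
Qed.

Lemma bounded_lin T : bounded_op T -> linear T.
Proof. by case. Qed.

Lemma bounded_comp A B : bounded_op A -> bounded_op B -> bounded_op (A \o B).
Proof.
move=> /boundedP[lA [M M0 AM]] /boundedP[lB [N N0 BN]]; apply/boundedP; split.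
  by move=> k x y /=; rewrite lB lA.
exists (M * N) => [|x /=]; first exact: mulr_gt0.
by apply: le_trans (AM _) _; rewrite -mulrA ler_pM2l.
Qed.

Lemma bounded_add A B : bounded_op A -> bounded_op B -> bounded_op (A \+ B).
Proof.
move=> /boundedP[lA [M M0 AM]] /boundedP[lB [N N0 BN]]; apply/boundedP; split.
  by move=> k x y /=; rewrite lA lB scalerDr addrACA.
exists (M + N) => [|x /=]; first exact: addr_gt0.
by apply: le_trans (nmD _ _) _; rewrite mulrDl lerD.
Qed.

Lemma bounded_scale k A : bounded_op A -> bounded_op (k \*: A).
Proof.
move=> /boundedP[lA [M M0 AM]]; apply/boundedP; split.
  by move=> l x y /=; rewrite lA scalerDr !scalerA mulrC.
exists ((complex.Re `|k| + 1) * M) => [|x /=].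
  by rewrite mulr_gt0 // ltr_wpDl ?cnorm_ge0.
rewrite nmZ -mulrA; apply: ler_pM; rewrite ?cnorm_ge0 ?nm_ge0 //.
by rewrite lerDl.
Qed.

Lemma bounded_sub A B : bounded_op A -> bounded_op B -> bounded_op (A \- B).
Proof.
move=> bA /(bounded_scale (-1)) bB; have := bounded_add bA bB.
by congr bounded_op; apply/funext => x /=; rewrite scaleN1r.
Qed.

Lemma bounded_id : bounded_op (@id H).
Proof.
by apply/boundedP; split=> //; exists 1 => // x; rewrite mul1r.
Qed.

Lemma bounded_proj S : closed_subspace S -> bounded_op (proj S).
Proof.
move=> cS; have [sS _] := cS; apply/boundedP; split.
  move=> k x y; apply: proj_eq => //.
    by apply: (proj2 sS); [case: (projP x cS) | case: (projP y cS)].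
  rewrite opprD addrACA -scalerBr => z Sz.
  by rewrite dotDl dotZl !(proj2 (projP _ cS)) // mulr0 addr0.
exists 1 => // x; rewrite mul1r -ler_sqr ?nnegrE ?nm_ge0 //.
have [Sx xp] := projP x cS.
have := nm_sqD (x - proj S x) (proj S x); rewrite subrK xp //= => ->.
by rewrite mulr0 addr0 lerDr sqr_ge0.
Qed.

(** Take [w] orthogonal to the kernel with [phi w != 0]. The vector [phi x *: w - phi w *: x] lies
    in the kernel, and its orthogonality to [w] is the formula for [phi x]. *)
Theorem riesz (phi : H -> R[i]) (M : R) : scalar phi ->
  (forall x, complex.Re `|phi x| <= M * nm x) ->
  exists z, forall x, phi x = '<[x, z]>.
Proof.
move=> lphi phiM.
have phi0 : phi 0 = 0.
  by have := lphi (-1) 0 0; rewrite scaler0 addr0 mulN1r addNr.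
have phiB x y : phi (x - y) = phi x - phi y.
  by rewrite addrC -scaleN1r lphi mulN1r addrC.
have phiZ k x : phi (k *: x) = k * phi x.
  by rewrite -[k *: x]addr0 lphi phi0 addr0.
have [phi_eq0|/existsNP[x0 x0P]] := pselect (forall x, phi x = 0).
  by exists 0 => x; rewrite dot0r phi_eq0.
have cK : closed_subspace [set x | phi x = 0].
  split; first by split=> // k x y /= px py; rewrite lphi px py mulr0 addr0.
  apply/closure_id/seteqP; split=> [|x /closureP xK /=]; first exact: subset_closure.
  have phi_small e : 0 < e -> complex.Re `|phi x| <= e.
    have M1 : 0 < `|M| + 1 by rewrite ltr_wpDl.
    move=> e0; have [y /= y0 xy] := xK _ (divr_gt0 e0 M1).
    rewrite -[phi x]subr0 -y0 -phiB; apply: le_trans (phiM _) _.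
    apply: le_trans (_ : (`|M| + 1) * nm (x - y) <= _).
      by rewrite ler_wpM2r ?nm_ge0 // ler_wpDr // ler_norm.
    by rewrite mulrC -ler_pdivlMr //; exact: ltW.
  apply/normr0_eq0; rewrite cnormE; congr (_%:C).
  apply/eqP; rewrite eq_le cnorm_ge0 andbT.
  by apply/ler_addgt0Pl => e /phi_small; rewrite addr0.
have [/= K0 w_orth] := projP x0 cK.
set w := x0 - _ in w_orth.
have phiw : phi w = phi x0 by rewrite phiB K0 subr0.
have w0 : '<[w, w]> != 0.
  apply/eqP => /dot_self_eq0 w0; apply: x0P; by rewrite -phiw w0.
exists (Num.conj (phi w / '<[w, w]>) *: w) => x.
have /w_orth/dot_eq0C/eqP : phi (phi x *: w - phi w *: x) = 0.
  by rewrite phiB !phiZ mulrC subrr.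
rewrite dotBl !dotZl subr_eq0 => /eqP xw.
by rewrite dotZr conjCK mulrAC -xw mulfK.
Qed.

Lemma adjoint_exists T : bounded_op T ->
  exists T', bounded_op T' /\ forall x y, '<[T x, y]> = '<[x, T' y]>.
Proof.
move=> /boundedP[lT [M M0 TM]].
have /choice[T' T'P] y : exists z, forall x, '<[T x, y]> = '<[x, z]>.
  apply: (@riesz (fun x => '<[T x, y]>) (M * nm y)) => [k x z|x].
    by rewrite lT dotDl dotZl.
  apply: le_trans (dot_le _ _) _.
  by rewrite mulrAC ler_wpM2r ?nm_ge0.
exists T'; split=> //; apply/boundedP; split=> [k y z|].
  by apply: dot_eq_r => x; rewrite -T'P !dotDr !dotZr -!T'P.
exists M => // y; have [->|ny] := eqVneq (nm (T' y)) 0.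
  by rewrite mulr_ge0 ?nm_ge0 // ltW.
have n0 : 0 < nm (T' y) by rewrite lt_def ny nm_ge0.
rewrite -(ler_pM2l n0) -expr2.
have <- : complex.Re '<[T' y, T' y]> = nm (T' y) ^+ 2 by rewrite dotxx.
rewrite -T'P; apply: le_trans (Re_dot_le _ _) _.
by rewrite mulrA ler_wpM2r ?nm_ge0 // mulrC.
Qed.

Lemma adjointP T : bounded_op T ->
  bounded_op (adjoint T) /\ forall x y, '<[T x, y]> = '<[x, adjoint T y]>.
Proof.
move=> /adjoint_exists.
exact: (@xgetPex _ (fun=> 0)
  [set T' | bounded_op T' /\ forall x y, '<[T x, y]> = '<[x, T' y]>]).
Qed.

Lemma adjoint_eq T T' : bounded_op T ->
  (forall x y, '<[T x, y]> = '<[x, T' y]>) -> adjoint T = T'.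
Proof.
move=> /adjointP[_ TP] T'P; apply/funext => y; apply: dot_eq_r => x.
by rewrite -TP T'P.
Qed.

Lemma selfadjointP T : selfadjoint_op T <->
  bounded_op T /\ forall x y, '<[T x, y]> = '<[x, T y]>.
Proof.
split=> [[bT aT]|[bT TP]]; split=> //; last exact: adjoint_eq.
by have [_ TP] := adjointP bT; rewrite aT in TP.
Qed.

Lemma selfadjoint_comp3 A B : selfadjoint_op A -> selfadjoint_op B ->
  selfadjoint_op (A \o B \o A).
Proof.
move=> /selfadjointP[bA AP] /selfadjointP[bB BP]; apply/selfadjointP.
split; first by do 2 apply: bounded_comp => //.
by move=> x y /=; rewrite AP BP AP.
Qed.

Lemma selfadjoint_proj S : closed_subspace S -> selfadjoint_op (proj S).
Proof.
by move=> cS; apply/selfadjointP; split=> [|x y]; [exact: bounded_proj|exact: proj_dot].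
Qed.

(** Polarisation: the form at [x + y] settles the imaginary parts, the form at [x + i y] the real
    parts. *)
Lemma dot_sym_polar (T : H -> H) : linear T ->
  (forall x, complex.Im '<[T x, x]> = 0) -> forall x y, '<[T x, y]> = '<[x, T y]>.
Proof.
move=> lT TIm x y; rewrite [RHS]dotC.
have h1 := TIm (x + y); have h2 := TIm (x + 'i%C *: y).
have hx := TIm x; have hy := TIm y.
move: h1 h2; rewrite !linD // linZ // !dotDl !dotDr !dotZr !dotZl.
rewrite -[Num.conj 'i%C]/(conjc 'i%C) -[Num.conj '<[_, _]>]/(conjc _).
move: hx hy; move: '<[T x, x]> '<[T y, y]> '<[T x, y]> '<[T y, x]>.
move=> [a a'] [b b'] [c c'] [d d'] /= -> -> h1 h2.
by apply/eqP; rewrite eq_complex /=; apply/andP; split; apply/eqP; lra.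
Qed.

End BoundedOperators.

(** * Positive square roots *)

Section PositiveOperators.
Context {R : realType} {H : hilbertType R}.
Implicit Types (x y z : H) (T A B C : H -> H) (k : R[i]).

Lemma positive_selfadjoint A : positive_op A -> selfadjoint_op A.
Proof.
move=> [bA A0]; apply/selfadjointP; split=> //.
apply: dot_sym_polar => [|x]; first exact: bounded_lin.
by have := A0 x; rewrite lecE => /andP[/eqP].
Qed.

Lemma positive_sym A x y : positive_op A -> '<[A x, y]> = '<[x, A y]>.
Proof. by move=> /positive_selfadjoint/selfadjointP[_]. Qed.

Lemma positive_Re A x : positive_op A -> 0 <= complex.Re '<[A x, x]>.
Proof. by move=> [_ /(_ x)]; rewrite lecE => /andP[]. Qed.

Lemma positive_op_Re A : bounded_op A ->
  (forall x y, '<[A x, y]> = '<[x, A y]>) ->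
  (forall x, 0 <= complex.Re '<[A x, x]>) -> positive_op A.
Proof.
move=> bA Asym A0; split=> // x; rewrite lecE A0 andbT; apply/eqP => /=.
by have := Im_dotC (A x) x; rewrite -Asym; lra.
Qed.

Lemma Re_dotxx x : complex.Re '<[x, x]> = nm x ^+ 2.
Proof. by rewrite dotxx. Qed.

(* Expand [0 <= <A (x - t A x), x - t A x>] at [t = 1 / M]. *)
Lemma positive_nm_sq A (M : R) x : positive_op A -> 0 < M ->
  (forall y, nm (A y) <= M * nm y) -> nm (A x) ^+ 2 <= M * complex.Re '<[A x, x]>.
Proof.
move=> pA M0 AM; have lA := bounded_lin pA.1.
have := positive_Re (x - (M^-1)%:C *: A x) pA.
rewrite linB // linZ // dotBl !dotBr !Re_add !Re_opp !Re_add !Re_opp.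
rewrite !Re_dotZr !dotZl !Re_realM !Re_dotxx (positive_sym (A x) x pA) Re_dotxx.
have : complex.Re '<[A (A x), A x]> <= M * nm (A x) ^+ 2.
  apply: le_trans (Re_dot_le _ _) _.
  by rewrite expr2 mulrA ler_wpM2r ?nm_ge0.
set a := complex.Re '<[A x, x]>; set b := complex.Re _; set c := _ ^+ 2 => bc h.
have Mi : 0 < M^-1 by rewrite invr_gt0.
have : M^-1 * (M^-1 * b) <= M^-1 * c.
  by rewrite ler_pM2l // mulrC ler_pdivrMr // mulrC.
move=> h2; have : M^-1 * c <= a by lra.
by rewrite mulrC ler_pdivrMr // mulrC.
Qed.

Lemma positive_dot_eq0 A x : positive_op A -> complex.Re '<[A x, x]> = 0 -> A x = 0.
Proof.
move=> pA Ax0; have /boundedP[_ [M M0 AM]] := pA.1.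
apply: nm0_eq0; apply/eqP; rewrite -sqrf_eq0 eq_le sqr_ge0 andbT.
by have := positive_nm_sq x pA M0 AM; rewrite Ax0 mulr0.
Qed.

Lemma le_rate (a b c : R) : (forall n : nat, a <= b + c / n.+1%:R) -> a <= b.
Proof.
move=> abc; apply/ler_addgt0Pr => e /(inv_succ_lt c)[N /(_ N (leqnn N)) Ne].
by apply: le_trans (abc N) _; rewrite lerD2l ltW.
Qed.

Lemma nm_rate x (c : R) : (forall n : nat, nm x <= c / n.+1%:R) -> x = 0.
Proof.
move=> xc; apply: nm0_eq0; apply/eqP; rewrite eq_le nm_ge0 andbT.
by apply: (@le_rate _ _ c) => n; rewrite add0r.
Qed.

Lemma cnorm_rate k (c : R) :
  (forall n : nat, complex.Re `|k| <= c / n.+1%:R) -> k = 0.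
Proof.
move=> xc; apply/normr0_eq0; rewrite cnormE; congr (_%:C).
apply/eqP; rewrite eq_le cnorm_ge0 andbT.
by apply: (@le_rate _ _ c) => n; rewrite add0r.
Qed.

End PositiveOperators.

(** * The square root of a positive contraction *)

Section SquareRootIteration.
Context {R : realType} {H : hilbertType R}.
Variables (A : H -> H) (pA : positive_op A) (A1 : forall x, nm (A x) <= nm x).
Implicit Types (x y z : H) (C : H -> H) (n m : nat).

(* The iteration for [Y = I - sqrt A], which solves [2 Y = (I - A) + Y ^ 2]. *)
Fixpoint sqrt_iter n x : H :=
  if n is m.+1 then (2^-1)%:C *: (x - A x + sqrt_iter m (sqrt_iter m x)) else 0.

(** The scalar recursion obtained by replacing [I - A] with its norm bound [1]. It increases to [1],
    and its increments dominate those of [sqrt_iter]. *)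
Fixpoint sqrt_maj n : R := if n is m.+1 then (1 + sqrt_maj m ^+ 2) / 2 else 0.

Local Notation Y := sqrt_iter.
Local Notation q := sqrt_maj.

Lemma sqrt_maj_bounds n : [/\ 0 <= q n, q n <= 1 & 1 - q n <= 2 / n.+1%:R].
Proof.
elim: n => [|n [q0 q1 qn]] /=; first by split; lra.
split; [nra | nra|].
have n0 : 0 < n.+1%:R :> R by rewrite ltr0n.
have n1 : 0 < n.+2%:R :> R by rewrite ltr0n.
rewrite ler_pdivlMr // in qn; rewrite ler_pdivlMr //.
rewrite (_ : n.+2%:R = n.+1%:R + 1 :> R); last by rewrite natr1.
move: (n.+1%:R) (q n) qn q0 q1 n0 => N Q qn q0 q1 n0.
(* With [e = 1 - Q] the recursion is [e -> e - e^2 / 2], which is increasing only for [e <= 1]. The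
   inductive bound [e <= 2 / N] can be inserted once [N >= 2]; for [N <= 2] the estimate
   [e - e^2 / 2 <= 1 / 2] suffices. *)
have [N2|N2] := lerP N 2.
  have : 0 <= Q ^+ 2 * (N + 1) by rewrite mulr_ge0 ?sqr_ge0 //; lra.
  lra.
set s := (1 - Q) * N in qn.
have h : 0 <= (N + 1) * ((2 - s) * (N - (2 + s) / 2)).
  by apply: mulr_ge0; [lra | apply: mulr_ge0; lra].
rewrite -(ler_pM2l (exprn_gt0 2 n0)).
have -> : N ^+ 2 * ((1 - (1 + Q ^+ 2) / 2) * (N + 1)) =
    (s * N - s ^+ 2 / 2) * (N + 1) by rewrite /s; field.
lra.
Qed.

Lemma sqrt_maj_le n m : (n <= m)%N -> q n <= q m.
Proof.
elim: m => [|m IHm]; first by rewrite leqn0 => /eqP ->.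
rewrite leq_eqVlt => /orP[/eqP -> //|/IHm h]; apply: le_trans h _ => /=.
by have := sqr_ge0 (1 - q m); nra.
Qed.

(** As [A] is a positive contraction, [|A x|^2 <= <A x, x>], so the cross term [- 2 <A x, x>]
    outweighs [|A x|^2]. *)
Lemma nm_contraction x : nm (x - A x) <= nm x.
Proof.
rewrite -ler_sqr ?nnegrE ?nm_ge0 // nm_sqB Re_dotC.
have : nm (A x) ^+ 2 <= 1 * complex.Re '<[A x, x]>.
  by apply: positive_nm_sq => // y; rewrite mul1r.
have := positive_Re x pA; lra.
Qed.

Lemma sqrt_iter_linear n : linear (Y n).
Proof.
have lA := bounded_lin pA.1.
elim: n => [|n IHn] k x y /=; first by rewrite scaler0 addr0.
rewrite !IHn lA !scalerA mulrC -scalerA -scalerDr; congr (_ *: _).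
by rewrite opprD scalerDr scalerBr (addrACA (k *: x)) [LHS]addrACA.
Qed.

Lemma sqrt_iter_bound n x : nm (Y n x) <= q n * nm x.
Proof.
elim: n x => [|n IHn] x /=; first by rewrite nm0 mul0r.
rewrite nmZr ger0_norm ?invr_ge0 // (mulrC (1 + _)) -mulrA.
rewrite ler_pM2l ?invr_gt0 //; apply: le_trans (nmD _ _) _.
rewrite mulrDl mul1r; apply: lerD; first exact: nm_contraction.
have [q0 _ _] := sqrt_maj_bounds n.
by rewrite expr2 -mulrA; apply: le_trans (IHn _) _; rewrite ler_wpM2l.
Qed.

Lemma sqrt_iter_step n x : nm (Y n.+1 x - Y n x) <= (q n.+1 - q n) * nm x.
Proof.
elim: n x => [|n IHn] x.
  rewrite /= subr0 addr0 expr0n addr0 subr0 nmZr ger0_norm ?invr_ge0 //.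
  by rewrite mul1r ler_pM2l ?invr_gt0 //; exact: nm_contraction.
(* The difference of squares is split as [Y' (Y' - Y) + (Y' - Y) Y], keeping the order of the
   factors; the majorant is split in the same way below. *)
have -> : Y n.+2 x - Y n.+1 x = (2^-1)%:C *:
    (Y n.+1 (Y n.+1 x - Y n x) + (Y n.+1 (Y n x) - Y n (Y n x))).
  rewrite (linB _ _ (sqrt_iter_linear n.+1)) addrA subrK -scalerBr; congr (_ *: _).
  by rewrite opprD addrACA subrr add0r.
rewrite nmZr ger0_norm ?invr_ge0 //.
have -> : q n.+2 - q n.+1 = 2^-1 * ((q n.+1 - q n) * q n.+1 + (q n.+1 - q n) * q n).
  by transitivity ((1 + q n.+1 ^+ 2) / 2 - (1 + q n ^+ 2) / 2) => //; field.
rewrite -mulrA ler_pM2l ?invr_gt0 //; apply: le_trans (nmD _ _) _.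
have [q0 _ _] := sqrt_maj_bounds n; have [q0' _ _] := sqrt_maj_bounds n.+1.
have dq : 0 <= q n.+1 - q n by rewrite subr_ge0 sqrt_maj_le.
rewrite mulrDl; apply: lerD.
  apply: le_trans (sqrt_iter_bound _ _) _.
  by rewrite (mulrC (q n.+1 - q n)) -[leRHS]mulrA ler_wpM2l.
apply: le_trans (IHn _) _; rewrite -[leRHS]mulrA ler_wpM2l //.
exact: sqrt_iter_bound.
Qed.

Lemma sqrt_iter_cauchy n m x : (n <= m)%N ->
  nm (Y m x - Y n x) <= 2 * nm x / n.+1%:R.
Proof.
move=> nm_; apply: (@le_trans _ _ ((q m - q n) * nm x)).
  elim: m nm_ => [|m IHm].
    by rewrite leqn0 => /eqP ->; rewrite !subrr nm0 mul0r.
  rewrite leq_eqVlt => /orP[/eqP ->|/IHm h]; first by rewrite !subrr nm0 mul0r.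
  apply: le_trans (nmB_trans (Y m x) _ _) _.
  have := sqrt_iter_step m x; lra.
rewrite mulrAC ler_wpM2r ?nm_ge0 //.
have [_ _ qn] := sqrt_maj_bounds n; have [_ qm _] := sqrt_maj_bounds m.
by apply: le_trans qn; rewrite lerD2r.
Qed.

Lemma sqrt_iter_sym n x y : '<[Y n x, y]> = '<[x, Y n y]>.
Proof.
elim: n x y => [|n IHn] x y /=; first by rewrite dot0l dot0r.
by rewrite dotZl dotZr conj_real dotDl dotDr dotBl dotBr !IHn positive_sym.
Qed.

Lemma sqrt_iter_comm C n x : linear C -> (forall y, C (A y) = A (C y)) ->
  C (Y n x) = Y n (C x).
Proof.
move=> lC CA; elim: n x => [|n IHn] x /=; first by rewrite lin0.
by rewrite linZ // linD // linB // CA !IHn.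
Qed.

(** The root is [I - Z] with [Z] the pointwise limit of the iterates. The commutation clause holds
    for each iterate and passes to the limit; uniqueness of the root depends on it. *)
Lemma sqrt_contraction_exists : exists X, [/\ positive_op X, X \o X = A &
  forall C x, bounded_op C -> (forall y, C (A y) = A (C y)) -> C (X x) = X (C x)].
Proof.
have /choice[Z ZP] x : exists l, forall n, nm (Y n x - l) <= 2 * nm x / n.+1%:R.
  apply: complete_rate => [e|n m]; first exact: inv_succ_lt.
  exact: sqrt_iter_cauchy.
have lY := sqrt_iter_linear.
have lZ : linear Z.
  move=> k x y; apply/eqP; rewrite -subr_eq0; apply/eqP.
  set c := 2 * nm (k *: x + y) + complex.Re `|k| * (2 * nm x) + 2 * nm y.
  apply: (@nm_rate _ _ _ c) => n.
  have -> : Z (k *: x + y) - (k *: Z x + Z y) = (Z (k *: x + y) - Y n (k *: x + y))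
      + (k *: (Y n x - Z x) + (Y n y - Z y)).
    by rewrite scalerBr (addrACA (k *: Y n x)) -lY -opprD addrA subrK.
  apply: le_trans (nmD _ _) _.
  rewrite /c mulrDl mulrDl -[leRHS]addrA; apply: lerD; first by rewrite nmBC; exact: ZP.
  apply: le_trans (nmD _ _) _; apply: lerD; last exact: ZP.
  by rewrite nmZ -[leRHS]mulrA; apply: ler_wpM2l (cnorm_ge0 k) _ _ (ZP x n).
have Z1 x : nm (Z x) <= nm x.
  apply: (@le_rate _ _ _ (2 * nm x)) => n.
  rewrite -[Z x]subr0; apply: le_trans (nmB_trans (Y n x) _ _) _.
  rewrite addrC subr0 nmBC lerD //; apply: le_trans (sqrt_iter_bound _ _) _.
  by have [_ q1 _] := sqrt_maj_bounds n; rewrite -[leRHS]mul1r ler_wpM2r ?nm_ge0.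
have bZ : bounded_op Z by apply/boundedP; split=> //; exists 1 => // x; rewrite mul1r.
have Zsym x y : '<[Z x, y]> = '<[x, Z y]>.
  apply/eqP; rewrite -subr_eq0; apply/eqP.
  apply: (@cnorm_rate _ _ (2 * nm x * nm y + nm x * (2 * nm y))) => n.
  have -> : '<[Z x, y]> - '<[x, Z y]> = '<[Z x - Y n x, y]> + '<[x, Y n y - Z y]>.
    by rewrite dotBl dotBr sqrt_iter_sym addrA subrK.
  apply: le_trans (_ : complex.Re `|'<[Z x - Y n x, y]>|
                       + complex.Re `|'<[x, Y n y - Z y]>| <= _).
    by rewrite -lecR rmorphD /= -!cnormE ler_normD.
  rewrite mulrDl lerD //; apply: le_trans (dot_le _ _) _.
    by rewrite mulrAC ler_wpM2r ?nm_ge0 // nmBC.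
  by rewrite -[leRHS]mulrA ler_wpM2l ?nm_ge0.
(* This is [(I - Z)^2 = A]. The constant [8] collects [2] from [Z (Z - Y n)], [2] from
   [(Z - Y n) (Y n)] and [4] from [2 (Y n.+1 - Z)]. *)
have ZZ x : Z (Z x) + (x - A x) = (2 : R)%:C *: Z x.
  apply/eqP; rewrite -subr_eq0; apply/eqP.
  apply: (@nm_rate _ _ _ (8 * nm x)) => n.
  have -> : Z (Z x) + (x - A x) - (2 : R)%:C *: Z x =
      Z (Z x - Y n x) + (Z (Y n x) - Y n (Y n x)) + (2 : R)%:C *: (Y n.+1 x - Z x).
    rewrite scalerBr /= scalerA -rmorphM /= divff ?pnatr_eq0 // scale1r.
    move: (x - A x) => w; rewrite (linB _ _ lZ) (addrC w (Y n _)) !addrA.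
    by rewrite subrK subrK addrAC.
  apply: le_trans (nmD _ _) _.
  apply: (@le_trans _ _ (2 * nm x / n.+1%:R + 2 * nm x / n.+1%:R +
     2 * (2 * nm x / n.+1%:R))); last first.
    have -> // : forall t w : R, 2 * w * t + 2 * w * t + 2 * (2 * w * t) = 8 * w * t.
    by move=> t w; ring.
  apply: lerD.
    apply: le_trans (nmD _ _) _; apply: lerD.
      by apply: le_trans (Z1 _) _; rewrite nmBC.
    rewrite nmBC; apply: le_trans (ZP _ _) _.
    rewrite ler_wpM2r ?invr_ge0 ?ler0n // ler_wpM2l //.
    apply: le_trans (sqrt_iter_bound _ _) _.
    by have [_ q1 _] := sqrt_maj_bounds n; rewrite -[leRHS]mul1r ler_wpM2r ?nm_ge0.
  rewrite nmZr ger0_norm // ler_wpM2l //; apply: le_trans (ZP _ _) _.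
  rewrite ler_wpM2l ?mulr_ge0 ?nm_ge0 //.
  by rewrite lef_pV2 ?posrE ?ltr0n // ler_nat.
exists (fun x => x - Z x); split.
- apply: positive_op_Re; first exact: (bounded_sub bounded_id bZ).
    by move=> x y; rewrite dotBl dotBr Zsym.
  move=> x; rewrite dotBl Re_add Re_opp Re_dotxx subr_ge0.
  apply: le_trans (Re_dot_le _ _) _; rewrite expr2.
  by rewrite ler_wpM2r ?nm_ge0.
- apply/funext => x /=; rewrite (linB _ _ lZ).
  rewrite (canRL (addrK _) (ZZ x)) rmorphMn /= scaler_nat mulr2n.
  by rewrite opprB (addrAC (Z x + Z x)) addrK addrA subrK opprB addrC subrK.
- move=> C x bC CA; have lC := bounded_lin bC; rewrite (linB _ _ lC); congr (_ - _).
  have /boundedP[_ [M M0 CM]] := bC.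
  apply/eqP; rewrite -subr_eq0; apply/eqP.
  apply: (@nm_rate _ _ _ (M * (2 * nm x) + 2 * nm (C x))) => n.
  have -> : C (Z x) - Z (C x) = C (Z x - Y n x) + (Y n (C x) - Z (C x)).
    by rewrite (linB _ _ lC) (sqrt_iter_comm _ _ lC CA) addrA subrK.
  apply: le_trans (nmD _ _) _; rewrite mulrDl lerD //.
  by apply: le_trans (CM _) _; rewrite -mulrA ler_pM2l // nmBC.
Qed.

End SquareRootIteration.

(** * Square roots and moduli in general *)

Section SquareRoot.
Context {R : realType} {H : hilbertType R}.
Implicit Types (x y z : H) (T A B C X Y r : H -> H).

Lemma positive_scale (t : R) A : 0 <= t -> positive_op A ->
  positive_op (t%:C \*: A).
Proof.
move=> t0 pA; apply: positive_op_Re => [|x y|x] /=.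
- by apply: bounded_scale; case: pA.
- by rewrite dotZl dotZr conj_real positive_sym.
- by rewrite dotZl Re_realM mulr_ge0 // positive_Re.
Qed.

Lemma sqrt_exists A : positive_op A -> exists X, [/\ positive_op X, X \o X = A &
  forall C x, bounded_op C -> (forall y, C (A y) = A (C y)) -> C (X x) = X (C x)].
Proof.
move=> pA; have /boundedP[lA [M M0 AM]] := pA.1.
have M1 : 0 <= M^-1 by rewrite invr_ge0 ltW.
have [x|X [pX XX XC]] := sqrt_contraction_exists (positive_scale M1 pA).
  by rewrite /= nmZr ger0_norm // mulrC ler_pdivrMr // mulrC.
have lX := bounded_lin pX.1.
exists ((Num.sqrt M)%:C \*: X); split.
- by apply: positive_scale => //; exact: sqrtr_ge0.
- apply/funext => x /=; rewrite (linZ _ _ lX) scalerA -rmorphM /= -expr2.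
  rewrite sqr_sqrtr ?ltW // (_ : X (X x) = (M^-1)%:C *: A x).
    by rewrite scalerA -rmorphM /= divff ?gt_eqF // scale1r.
  by have /(congr1 (@^~ x)) := XX.
- move=> C x bC CA /=; have lC := bounded_lin bC.
  by rewrite (linZ _ _ lC) XC // => y /=; rewrite (linZ _ _ lC) CA.
Qed.

(** For [y = (X - Y) x], commutation gives [(X + Y) y = (X^2 - Y^2) x = 0]. Both [<X y, y>] and
    [<Y y, y>] are nonnegative, hence zero, so [X y = Y y = 0] and [<y, y> = <(X - Y) y, x> = 0]. *)
Lemma sqrt_unique A X Y : positive_op X -> positive_op Y ->
  X \o X = A -> Y \o Y = A -> (forall x, X (Y x) = Y (X x)) -> X = Y.
Proof.
move=> pX pY XX YY XY; apply/funext => x.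
have lX := bounded_lin pX.1; have lY := bounded_lin pY.1.
have XXYY z : X (X z) = Y (Y z) by rewrite -[LHS]/((X \o X) z) XX -YY.
set y := X x - Y x.
have XyYy : X y + Y y = 0.
  by rewrite /y (linB _ _ lX) (linB _ _ lY) XXYY XY addrA subrK subrr.
have /(congr1 (fun z => complex.Re '<[z, y]>)) := XyYy.
rewrite dotDl Re_add dot0l /= => y0.
have := positive_Re y pX; have := positive_Re y pY => Y0 X0.
have Xy : X y = 0 by apply: positive_dot_eq0 => //; lra.
have Yy : Y y = 0 by apply: positive_dot_eq0 => //; lra.
apply/eqP; rewrite -subr_eq0; apply/eqP/dot_self_eq0.
by rewrite -/y {2}/y dotBr -!positive_sym // Xy Yy subrr.
Qed.

(** Any root of [A] commutes with [A], hence with the root [X] of [sqrt_exists]. So the root picked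
    by [xget] is [X] and inherits its commutation clause. *)
Lemma sqrt_opP A : positive_op A -> [/\ positive_op (sqrt_op A),
  forall x, sqrt_op A (sqrt_op A x) = A x &
  forall C x, bounded_op C -> (forall y, C (A y) = A (C y)) ->
    C (sqrt_op A x) = sqrt_op A (C x)].
Proof.
move=> pA; have [X [pX XX XC]] := sqrt_exists pA.
have [pr rr] : positive_op (sqrt_op A) /\ sqrt_op A \o sqrt_op A = A.
  apply: (@xgetPex _ (fun=> 0) [set X | positive_op X /\ X \o X = A]).
  by exists X.
have rrx x : sqrt_op A (sqrt_op A x) = A x by rewrite -{3}rr.
have rX : sqrt_op A = X.
  apply: (sqrt_unique pr pX rr XX) => x; apply: XC; first by case: pr.
  by move=> y; rewrite -!rrx.
split=> //; rewrite rX; exact: XC.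
Qed.

Lemma sqrt_op_eq0 A x : positive_op A -> sqrt_op A x = 0 <-> A x = 0.
Proof.
move=> /sqrt_opP[pr rr _]; rewrite -rr; split=> [->|rrx].
  by rewrite lin0 //; apply: bounded_lin; case: pr.
by apply: dot_self_eq0; rewrite -positive_sym // rrx dot0l.
Qed.

Lemma modulusP T : bounded_op T -> [/\ positive_op (modulus T),
  forall x, modulus T (modulus T x) = adjoint T (T x),
  forall x, nm (modulus T x) = nm (T x) &
  forall C x, bounded_op C -> (forall y, C (adjoint T (T y)) = adjoint T (T (C y))) ->
    C (modulus T x) = modulus T (C x)].
Proof.
move=> bT; have [bT' TT'] := adjointP bT.
have pTT : positive_op (adjoint T \o T).
  split=> [|x /=]; first exact: bounded_comp.
  by rewrite dotC -TT' -dotC dotxx lecR sqr_ge0.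
have [pm mm mC] := sqrt_opP pTT; split=> // x.
apply/eqP; rewrite -(@eqrXn2 _ 2) ?nm_ge0 //; apply/eqP/complexI.
by rewrite -!dotxx positive_sym // [modulus T _]mm -TT'.
Qed.

Lemma modulus_eq0 T x : bounded_op T -> modulus T x = 0 <-> T x = 0.
Proof.
move=> /modulusP[_ _ nmT _]; split=> Tx0; apply: nm0_eq0.
  by rewrite -nmT Tx0 nm0.
by rewrite nmT Tx0 nm0.
Qed.

End SquareRoot.

(** * Range and nullspace of a selfadjoint operator *)

Section RangeAndKernel.
Context {R : realType} {H : hilbertType R}.
Implicit Types (x y z : H) (T A B X : H -> H).

Lemma range_subspace T : linear T -> subspace (range T).
Proof.
move=> lT; split; first by exists 0 => //; exact: lin0.
by move=> k _ _ [x _ <-] [y _ <-]; exists (k *: x + y) => //; rewrite lT.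
Qed.

Lemma orthocomp_range X x : selfadjoint_op X -> orthocomp (range X) x <-> X x = 0.
Proof.
move=> /selfadjointP[bX Xsym]; split=> [Xx|Xx _ [y _ <-]].
  by apply: dot_self_eq0; rewrite Xsym; apply: Xx; exists (X x).
by rewrite -Xsym Xx dot0l.
Qed.

Lemma closure_range_eq0 X x : selfadjoint_op X -> closure (range X) x ->
  X x = 0 -> x = 0.
Proof.
move=> sX Xx /(orthocomp_range x sX)/orthocomp_closure oXx.
exact/dot_self_eq0/oXx.
Qed.

Lemma orthocomp_range_null X x : selfadjoint_op X -> orthocomp (range X) x ->
  orthocomp (nullspace X) x -> x = 0.
Proof. by move=> sX /(orthocomp_range x sX) Xx Nx; apply/dot_self_eq0/Nx. Qed.

(** For selfadjoint [X] only [0] is orthogonal to both [R(X)] and [N(X)]; this is applied to the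
    values of [adjoint A - adjoint B]. *)
Lemma eq_on_range_null X A B : selfadjoint_op X -> bounded_op A -> bounded_op B ->
  (forall x, A (X x) = B (X x)) -> (forall x, X x = 0 -> A x = B x) -> A = B.
Proof.
move=> sX bA bB ABr ABn; have [_ AP] := adjointP bA; have [_ BP] := adjointP bB.
suff AB y : adjoint A y = adjoint B y.
  by apply/funext => x; apply: dot_eq_l => y; rewrite AP BP AB.
apply/eqP; rewrite -subr_eq0; apply/eqP; apply: (orthocomp_range_null sX) => z.
  move=> [x _ <-]; apply: dot_eq0C.
  by rewrite dotBr -AP -BP ABr subrr.
move=> /ABn Az; apply: dot_eq0C.
by rewrite dotBr -AP -BP Az subrr.
Qed.

End RangeAndKernel.

(** * Polar decomposition and Douglas' lemma *)

Section Polar.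
Context {R : realType} {H : hilbertType R}.
Variables (T : H -> H) (bT : bounded_op T).
Implicit Types (x y z : H) (u : H -> H).

Local Notation m := (modulus T).
Local Notation S := (closure (range (modulus T))).

Let bm : bounded_op m. Proof. by have [[]] := modulusP bT. Qed.
Let lm : linear m. Proof. exact: bounded_lin. Qed.
Let lT : linear T. Proof. exact: bounded_lin. Qed.
Let cS : closed_subspace S.
Proof. by apply: closure_subspace; exact: range_subspace. Qed.
Let nmT x : nm (m x) = nm (T x). Proof. by have [_ _ + _] := modulusP bT. Qed.

Let approx z n : exists y, nm (proj S z - m y) <= 2 / n.+1%:R.
Proof.
have [/closureP Sz _] := projP z cS.
have n0 : 0 < 2 / n.+1%:R :> R by rewrite divr_gt0 ?ltr0n.
by have [_ [y _ <-] zy] := Sz _ n0; exists y; exact: ltW.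
Qed.

(* The values of the polar isometry are limits of [T y] along [m y --> proj S z]. *)
Let polar_value z : exists l, forall n, exists y,
  nm (proj S z - m y) <= 2 / n.+1%:R /\ nm (l - T y) <= 4 / n.+1%:R.
Proof.
have /choice[y yP] := approx z.
have [e|n p np|l lP] := @complete_rate _ _ (fun n => T (y n)) (fun n => 4 / n.+1%:R).
- exact: inv_succ_lt.
- rewrite -linB // -nmT linB //; apply: le_trans (nmB_trans (proj S z) _ _) _.
  have := yP n; have := yP p; rewrite nmBC => yp yn.
  have : 2 / p.+1%:R <= 2 / n.+1%:R :> R.
    by rewrite ler_pM2l // lef_pV2 ?posrE ?ltr0n // ler_nat.
  move: yp yn; move: (p.+1%:R^-1) (n.+1%:R^-1) => a b; lra.
- by exists l => n; exists (y n); split; [exact: yP | rewrite nmBC; exact: lP].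
Qed.

Lemma polar_exists : exists u, [/\ partial_isometry u, nullspace u = nullspace T
  & T = u \o m].
Proof.
have /choice[u uP] := polar_value.
(* Thus [u] is isometric on [S] and zero on its complement. The constant [6] adds the errors [2] for
   [m y] and [4] for [T y], where [m y] and [T y] have equal norms. *)
have nmu z : nm (u z) = nm (proj S z).
  apply/eqP; rewrite eq_le; apply/andP; split; apply: (@le_rate _ _ _ 6) => n;
    have [y [zy uy]] := uP z n; have := nmT y.
    have := nmB_trans (T y) (u z) 0; have := nmB_trans (proj S z) (m y) 0.
    rewrite !subr0 (nmBC (m y)); move: zy uy; move: (n.+1%:R^-1) => t; lra.
  have := nmB_trans (m y) (proj S z) 0; have := nmB_trans (u z) (T y) 0.
  rewrite !subr0 (nmBC (T y)); move: zy uy; move: (n.+1%:R^-1) => t; lra.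
have lP : linear (proj S) by exact/bounded_lin/bounded_proj.
have lu : linear u.
  move=> k x y; apply/eqP; rewrite -subr_eq0; apply/eqP.
  set c := complex.Re `|k|.
  apply: (@nm_rate _ _ _ (12 + c * 6)) => n.
  have [x1 [xx1 ux1]] := uP x n; have [y1 [yy1 uy1]] := uP y n.
  have [z1 [zz1 uz1]] := uP (k *: x + y) n.
  have e1 : u (k *: x + y) - (k *: u x + u y) = (u (k *: x + y) - T z1) +
      (T (z1 - (k *: x1 + y1)) - (k *: (u x - T x1) + (u y - T y1))).
    rewrite (linB _ _ lT) lT scalerBr (addrACA (k *: u x)) -opprD opprB.
    by move: (k *: T x1 + T y1) => w; rewrite !addrA subrK subrK.
  have e2 : m (z1 - (k *: x1 + y1)) = - (proj S (k *: x + y) - m z1) +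
      (k *: (proj S x - m x1) + (proj S y - m y1)).
    rewrite (linB _ _ lm) lm lP scalerBr (addrACA (k *: proj S x)) -opprD opprB.
    by move: (k *: proj S x + proj S y) => w; rewrite !addrA subrK.
  have h1 : nm (m (z1 - (k *: x1 + y1))) <= 2 / n.+1%:R +
      (c * (2 / n.+1%:R) + 2 / n.+1%:R).
    rewrite e2; apply: le_trans (nmD _ _) _; rewrite nmN lerD //.
    apply: le_trans (nmD _ _) _; rewrite lerD // nmZ.
    by rewrite ler_wpM2l // cnorm_ge0.
  have h2 : nm (k *: (u x - T x1) + (u y - T y1)) <=
      c * (4 / n.+1%:R) + 4 / n.+1%:R.
    apply: le_trans (nmD _ _) _; rewrite lerD // nmZ.
    by rewrite ler_wpM2l // cnorm_ge0.
  rewrite e1; apply: le_trans (nmD _ _) _.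
  rewrite nmT in h1.
  have := nmD (T (z1 - (k *: x1 + y1))) (- (k *: (u x - T x1) + (u y - T y1))).
  rewrite nmN; move: uz1 h1 h2; move: (n.+1%:R^-1) => t uz1 h1 h2 h3.
  have -> : (12 + c * 6) * t = 4 * t + (2 * t + (c * (2 * t) + 2 * t)) +
     (c * (4 * t) + 4 * t) by ring.
  lra.
have um x : u (m x) = T x.
  apply/eqP; rewrite -subr_eq0; apply/eqP.
  apply: (@nm_rate _ _ _ 6) => n; have [y [xy uy]] := uP (m x) n.
  have Smx : proj S (m x) = m x.
    by apply: proj_id; [case: cS | apply: subset_closure; exists x].
  rewrite Smx -linB // nmT linB // in xy.
  have := nmB_trans (T y) (u (m x)) (T x); rewrite (nmBC (T y)).
  move: xy uy; move: (n.+1%:R^-1) => t; lra.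
have u_eq0 z : u z = 0 <-> proj S z = 0.
  by split=> z0; apply: nm0_eq0; [rewrite -nmu|rewrite nmu]; rewrite z0 nm0.
have sm : selfadjoint_op m by apply: positive_selfadjoint; have [] := modulusP bT.
have PT z : proj S z = 0 <-> T z = 0.
  rewrite -(modulus_eq0 _ bT) -(orthocomp_range _ sm); split=> [z0|oz].
    have [_] := projP z cS; rewrite z0 subr0 => oz y ry.
    by apply: oz; apply: subset_closure.
  by apply: proj_eq0; [case: cS | exact: orthocomp_closure].
exists u; split; last by apply/funext => x /=; rewrite um.
  split; first apply/boundedP.
    split=> //; have /boundedP[_ [M M0 PM]] := bounded_proj cS.
    by exists M => // x; rewrite nmu.
  move=> x Nx; rewrite !normE nmu; congr ((nm _)%:C).
  have [Sx xS] := projP x cS.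
  apply/eqP; rewrite eq_sym -subr_eq0; apply/eqP/dot_self_eq0.
  have uxP : nullspace u (x - proj S x).
    by apply/u_eq0; apply: proj_eq0 => //; case: cS.
  by rewrite {1}dotBl (Nx _ uxP) sub0r (dot_eq0C (xS _ Sx)) oppr0.
by apply/seteqP; split=> x /=; rewrite /nullspace /= u_eq0 PT.
Qed.

Lemma polarP : [/\ partial_isometry (polar T), nullspace (polar T) = nullspace T
  & T = polar T \o m].
Proof.
exact: (@xgetPex _ (fun=> 0) [set u | [/\ partial_isometry u,
  nullspace u = nullspace T & T = u \o modulus T]] polar_exists).
Qed.

End Polar.

(** * Uniform boundedness and Douglas factorization *)

Section Douglas.
Context {R : realType} {H : hilbertType R}.
Implicit Types (x y z v w : H) (A B : H -> H) (F : set H).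

(* Gliding hump: if [v n] in [F] has norm at least [4 ^ n], steps of length
   [3 ^- n] along [v n] lead to a point [x] with
   [`|Re <x, v n>| >= 3 ^- n / 2 * nm (v n)]. *)
Theorem uniform_boundedness F :
  (forall x, exists M : R, forall v, F v -> complex.Re '<[x, v]> <= M) ->
  exists K : R, forall v, F v -> nm v <= K.
Proof.
move=> Fb; apply: contrapT => Funb.
have /choice[v vP] : forall n : nat, exists v, F v /\ 4 ^+ n < nm v.
  move=> n; apply: contrapT => nv; apply: Funb; exists (4 ^+ n) => v Fv.
  by rewrite leNgt; apply/negP => nmv; apply: nv; exists v.
pose t n : R := 3^-1 ^+ n.
have t0 n : 0 < t n by rewrite exprn_gt0 // invr_gt0.
have v0 n : 0 < nm (v n) by apply: lt_trans (vP n).2; rewrite exprn_gt0.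
(* The sign makes the step push [Re <x, v n>] away from zero. *)
pose s n x : R := if 0 <= complex.Re '<[x, v n]> then 1 else -1.
pose step n x := x + (s n x * t n / nm (v n))%:C *: v n.
pose X := fix X n := if n is p.+1 then step p (X p) else 0.
have s1 n x : `|s n x| = 1 by rewrite /s; case: ifP; rewrite ?normrN normr1.
have stepP n : nm (X n.+1 - X n) = t n.
  rewrite /= /step addrC addKr nmZr !normrM s1 mul1r normfV.
  by rewrite (gtr0_norm (t0 n)) (gtr0_norm (v0 n)) divfK // gt_eqF.
have stepv n x : t n * nm (v n) <= `|complex.Re '<[step n x, v n]>|.
  rewrite /step dotDl dotZl Re_add Re_realM Re_dotxx.
  have -> : s n x * t n / nm (v n) * nm (v n) ^+ 2 = s n x * (t n * nm (v n)).
    by rewrite expr2 -!mulrA mulKf // gt_eqF.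
  have p0 : 0 < t n * nm (v n) by rewrite mulr_gt0.
  rewrite /s; case: (lerP 0 (complex.Re '<[x, v n]>)) => h.
    by rewrite mul1r ger0_norm ?lerDr // addr_ge0 // ltW.
  rewrite mulN1r ltr0_norm; last by rewrite subr_lt0 (lt_trans h).
  by rewrite opprB lerBrDr gerDl ltW.
have tS n : t n.+1 = t n / 3 by rewrite /t exprS mulrC.
(* [3 / 2] is the sum of the geometric series of ratio [1 / 3]. After [X n.+1] the remaining steps
   move by at most [t n / 2], so half of the gain [t n * nm (v n)] survives in the limit. *)
have Xc n p : (n <= p)%N -> nm (X p - X n) <= 3 / 2 * t n.
  move=> np; apply: (@le_trans _ _ (3 / 2 * (t n - t p))); last first.
    by have := t0 p; lra.
  elim: p np => [|p IHp]; first by rewrite leqn0 => /eqP ->; rewrite !subrr nm0 mulr0.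
  rewrite leq_eqVlt => /orP[/eqP ->|/IHp h]; first by rewrite !subrr nm0 mulr0.
  apply: le_trans (nmB_trans (X p) _ _) _; rewrite stepP tS; lra.
(* Used with [a = 2], so that [t n <= 1 / n.+1], and with [a = 1 / 3], so that [t n * 4 ^+ n] is
   unbounded. *)
have bernoulli (a : R) n : 0 <= a -> 1 + a * n%:R <= (1 + a) ^+ n.
  move=> a0; elim: n => [|n IHn]; first by rewrite mulr0 addr0 expr0.
  rewrite exprS; apply: le_trans (_ : (1 + a) * (1 + a * n%:R) <= _).
    have : 0 <= n%:R :> R by rewrite ler0n.
    rewrite -natr1; move: (n%:R) => N N0; nra.
  by rewrite ler_wpM2l //; lra.
have tlim e : 0 < e -> exists N : nat, forall n, (N <= n)%N -> 3 / 2 * t n < e.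
  move=> e0; have [N NP] := inv_succ_lt (3 / 2) e0; exists N => n /NP.
  apply: le_lt_trans; rewrite ler_pM2l; last by lra.
  rewrite /t exprVn lef_pV2 ?posrE ?exprn_gt0 ?ltr0n //.
  have := bernoulli 2 n; rewrite (_ : 1 + 2 = 3); last by ring.
  move=> /(_ (ler0n _ _)); apply: le_trans; rewrite -natr1.
  have : 0 <= n%:R :> R by rewrite ler0n.
  lra.
have [x xP] := complete_rate tlim Xc.
have [M1 M1P] := Fb x; have [M2 M2P] := Fb (- x).
have big n : 1 + 3^-1 * n%:R <= 2 * (`|M1| + `|M2|).
  apply: le_trans (bernoulli 3^-1 n _) _; first by rewrite invr_ge0.
  have -> : (1 + 3^-1) ^+ n = t n * 4 ^+ n :> R.
    by rewrite /t -exprMn; congr (_ ^+ n); field.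
  apply: le_trans (_ : t n * nm (v n) <= _).
    by rewrite ler_wpM2l ?(ltW (t0 n)) // ltW // (vP n).2.
  have := stepv n (X n); have := xP n.+1; rewrite tS => xn.
  rewrite -[step n (X n)]/(X n.+1) -(subrK x (X n.+1)) dotDl Re_add => h.
  have h1 : complex.Re '<[X n.+1 - x, v n]> <= t n / 2 * nm (v n).
    apply: le_trans (Re_dot_le _ _) _; rewrite ler_wpM2r ?nm_ge0 //; lra.
  have h2 : - complex.Re '<[X n.+1 - x, v n]> <= t n / 2 * nm (v n).
    rewrite -Re_opp -dotNl; apply: le_trans (Re_dot_le _ _) _.
    by rewrite nmN ler_wpM2r ?nm_ge0 //; lra.
  have h3 := M1P _ (vP n).1; have := M2P _ (vP n).1; rewrite dotNl Re_opp => h4.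
  have := ler_norm M1; have := ler_norm M2.
  have := normr_ge0 M1; have := normr_ge0 M2.
  by rewrite ler_normr in h; case/orP: h => h; lra.
have [N NP] : exists N : nat, 2 * (`|M1| + `|M2|) < 3^-1 * N%:R.
  exists (Num.truncn (3 * (2 * (`|M1| + `|M2|)))).+1.
  by rewrite -ltr_pdivrMl ?invr_gt0 // invrK truncnS_gt.
by have := big N; lra.
Qed.

(** [f x] is the preimage of [B x] lying in the closure of [R(A)]. For boundedness,
    [<x, adjoint B z> = <f x, A z>] shows that the vectors [adjoint B z] with [nm (A z) <= 1] are
    weakly bounded; uniform boundedness then controls [f x] against [R(A)]. *)
Theorem douglas A B : selfadjoint_op A -> bounded_op B -> range B `<=` range A ->
  exists f, [/\ bounded_op f, B = A \o f, nullspace f = nullspace B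
    & range f `<=` closure (range A)].
Proof.
move=> sA bB BA; have [bA Asym] := (selfadjointP A).1 sA.
have lA := bounded_lin bA; have lB := bounded_lin bB.
have cS := closure_subspace (range_subspace lA).
set S := closure (range A) in cS *.
have /choice[f fP] x : exists y, S y /\ A y = B x.
  have [y _ yx] : range A (B x) by apply: BA; exists x.
  have [Sy yS] := projP y cS; exists (proj S y); split=> //.
  have /(orthocomp_range _ sA) : orthocomp (range A) (y - proj S y).
    by move=> z rz; apply: yS; apply: subset_closure.
  by rewrite linB // yx => /eqP; rewrite subr_eq0 => /eqP.
have lf : linear f.
  move=> k x y; apply/eqP; rewrite -subr_eq0; apply/eqP.
  apply: (closure_range_eq0 sA).
    apply: (subspaceB cS.1); first by case: (fP (k *: x + y)).
    by apply: cS.1.2; [case: (fP x) | case: (fP y)].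
  by rewrite linB // lA (fP (k *: x + y)).2 (fP x).2 (fP y).2 lB subrr.
have [_ BP] := adjointP bB.
have fA x z : '<[f x, A z]> = '<[x, adjoint B z]>.
  by rewrite -Asym (fP x).2 BP.
have [|K KP] := @uniform_boundedness [set adjoint B z | z in [set z | nm (A z) <= 1]].
  move=> x; exists (nm (f x)) => _ [z /= Az1 <-]; rewrite -fA.
  apply: le_trans (Re_dot_le _ _) _.
  by rewrite -[leRHS]mulr1 ler_wpM2l ?nm_ge0.
have K0 : 0 <= K.
  apply: le_trans (nm_ge0 (adjoint B 0)) (KP _ _); exists 0 => //=.
  by rewrite lin0 // nm0.
have fAle x z : complex.Re '<[f x, A z]> <= K * nm x * nm (A z).
  have [Az0|Az0] := eqVneq (nm (A z)) 0.
    by rewrite (nm0_eq0 Az0) dot0r nm0 mulr0.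
  have Az_gt0 : 0 < nm (A z) by rewrite lt_def Az0 nm_ge0.
  pose z1 := ((nm (A z))^-1)%:C *: z.
  have Az : A z = (nm (A z))%:C *: A z1.
    by rewrite linZ // scalerA -rmorphM /= divff // scale1r.
  have z1P : nm (A z1) <= 1.
    by rewrite linZ // nmZr ger0_norm ?invr_ge0 ?nm_ge0 // mulVf.
  rewrite {1}Az Re_dotZr mulrC ler_pM2r // fA.
  apply: le_trans (Re_dot_le _ _) _; rewrite mulrC ler_wpM2r ?nm_ge0 //.
  by apply: KP; exists z1.
exists f; split.
- apply/boundedP; split=> //; exists (K + 1) => [|x]; first by rewrite ltr_wpDl.
  (* Approximate [f x] by elements [A z] and pass to the limit in [fAle]. *)
  have : nm (f x) ^+ 2 <= K * nm x * nm (f x).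
    apply: (@le_rate _ _ _ (K * nm x + nm (f x))) => n.
    have n0 : 0 < n.+1%:R^-1 :> R by rewrite invr_gt0 ltr0n.
    have [/closureP/(_ _ n0)[_ [z _ <-] fz] _] := fP x.
    have h := fAle x z.
    have h1 := Re_dot_le (f x) (f x - A z).
    rewrite dotBr Re_add Re_opp Re_dotxx in h1.
    have h2 : nm (A z) <= nm (f x) + n.+1%:R^-1.
      rewrite -[A z](subrK (f x)) addrC; apply: le_trans (nmD _ _) _.
      by rewrite lerD2l nmBC ltW.
    have f0 := nm_ge0 (f x).
    have Kx : 0 <= K * nm x by rewrite mulr_ge0 ?nm_ge0.
    have := ler_wpM2l Kx h2; have := ler_wpM2l f0 (ltW fz).
    move: h h1; move: (n.+1%:R^-1) => e; lra.
  have [->|fx0] := eqVneq (nm (f x)) 0; first by rewrite mulr_ge0 ?nm_ge0 // addr_ge0.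
  rewrite expr2 ler_pM2r; last by rewrite lt_def fx0 nm_ge0.
  by have := nm_ge0 x; lra.
- by apply/funext => x /=; rewrite (fP x).2.
- apply/seteqP; split=> x /= fx0; rewrite /nullspace /=.
    by rewrite -(fP x).2 fx0 lin0.
  by apply: (closure_range_eq0 sA); [case: (fP x) | rewrite (fP x).2].
- by move=> _ [x _ <-]; case: (fP x).
Qed.

Lemma reduced_solutionP A B : selfadjoint_op A -> bounded_op B ->
  range B `<=` range A -> let f := reduced_solution A B in
  [/\ bounded_op f, B = A \o f, nullspace f = nullspace B
    & range f `<=` closure (range A)].
Proof.
move=> sA bB BA; exact: (@xgetPex _ (fun=> 0) [set f | [/\ bounded_op f,
  B = A \o f, nullspace f = nullspace B & range f `<=` closure (range A)]]
  (douglas sA bB BA)).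
Qed.

End Douglas.

(** * The projection attached to a Schur complement *)

Section PolarSelfadjoint.
Context {R : realType} {H : hilbertType R}.
Variables (a : H -> H) (sa : selfadjoint_op a).
Implicit Types x y z : H.

Local Notation m := (modulus a).
Local Notation r := (sqrt_op (modulus a)).
Local Notation u := (polar a).

Let ba : bounded_op a. Proof. by case: sa. Qed.
Let pm : positive_op m. Proof. by have [] := modulusP ba. Qed.
Let pr : positive_op r. Proof. by have [] := sqrt_opP pm. Qed.
Let rr x : r (r x) = m x. Proof. by have [] := sqrt_opP pm. Qed.
Let bu : bounded_op u. Proof. by have [[]] := polarP ba. Qed.
Let uE x : a x = u (m x).
Proof. by have [_ _] := polarP ba => /(congr1 (@^~ x)). Qed.

Lemma sqrt_modulus_eq0 x : r x = 0 <-> a x = 0.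
Proof. by rewrite (sqrt_op_eq0 x pm) (modulus_eq0 x ba). Qed.

Lemma polar_eq0 x : u x = 0 <-> a x = 0.
Proof.
have [_ nu _] := polarP ba.
by rewrite -[u x = 0]/(nullspace u x) nu.
Qed.

Let a_sqrt x : a (r x) = r (a x).
Proof.
have [_ _ rC] := sqrt_opP pm; have [_ _ _ mC] := modulusP ba.
by apply: rC => // y; apply: mC => // z; rewrite sa.2.
Qed.

(** On [R(m)] both sides reduce to [r a], because [u m = a] and [r] commutes with [a] and [m]; on
    [N(m)] both vanish, since [m], [a], [r] and [u] share their nullspace. *)
Lemma polar_sqrtC x : u (r x) = r (u x).
Proof.
have lr := bounded_lin pr.1; have lu := bounded_lin bu.
suff : u \o r = r \o u by move=> /(congr1 (@^~ x)).
apply: (eq_on_range_null (positive_selfadjoint pm)).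
- exact: bounded_comp pr.1.
- exact: bounded_comp pr.1 bu.
- by move=> y /=; rewrite -uE -a_sqrt -!rr uE rr.
- move=> y /(modulus_eq0 _ ba) ay /=.
  by rewrite (sqrt_modulus_eq0 y).2 // (polar_eq0 y).2 // !lin0.
Qed.

Lemma polar_factor x : a x = r (u (r x)).
Proof. by rewrite -polar_sqrtC rr. Qed.

(** Checked on [R(a a)], where [a a = m m] lets [u m = a] be used twice, and on [N(a a) = N(a)]. *)
Lemma polar_polar_sqrt x : u (u (r x)) = r x.
Proof.
have lr := bounded_lin pr.1; have lu := bounded_lin bu.
suff : u \o u \o r = r by move=> /(congr1 (@^~ x)).
have smm : selfadjoint_op (a \o a).
  apply/selfadjointP; have [_ asym] := (selfadjointP a).1 sa.
  by split=> [|y z /=]; [exact: bounded_comp | rewrite !asym].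
have mm y : m (m y) = a (a y) by have [_ + _ _] := modulusP ba; rewrite sa.2.
apply: (eq_on_range_null smm); first exact: bounded_comp (bounded_comp bu bu) pr.1.
- exact: pr.1.
- move=> y /=; rewrite -[in LHS]a_sqrt -[in LHS]a_sqrt -mm -uE.
  rewrite (_ : a (m (r y)) = m (a (r y))); last first.
    by have [_ _ _ mC] := modulusP ba; apply: mC => // z; rewrite sa.2.
  by rewrite -uE -!a_sqrt.
- move=> y /= aay; suff ay : a y = 0 by rewrite (sqrt_modulus_eq0 y).2 // !lin0.
  have [_ asym] := (selfadjointP a).1 sa.
  by apply: dot_self_eq0; rewrite -asym aay dot0l.
Qed.

(** On [R(m)] symmetry of [a = u m = m u] gives the equality. For [y] in [N(m)], [adjoint u y] is
    orthogonal to [R(m)] because [a y = 0], and to [N(m)] because [u] vanishes there. *)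
Lemma selfadjoint_polar : selfadjoint_op u.
Proof.
have [bu' uu'] := adjointP bu; split=> //.
have [_ asym] := (selfadjointP a).1 sa.
have sm := positive_selfadjoint pm.
apply: (eq_on_range_null sm) => // y.
  rewrite -uE; apply: dot_eq_r => z; rewrite -uu' -(positive_sym _ _ pm).
  by rewrite -!rr -!polar_sqrtC rr -uE asym.
move=> my; have ay : a y = 0 by exact/(modulus_eq0 _ ba).
rewrite (polar_eq0 y).2 //; apply: (orthocomp_range_null sm).
  by move=> _ [z _ <-]; rewrite dotC -uu' -uE asym ay dot0r rmorph0.
move=> z /(modulus_eq0 _ ba) az.
by rewrite dotC -uu' (polar_eq0 z).2 // dot0l rmorph0.
Qed.

End PolarSelfadjoint.

(** * Block entries of [B] relative to [S] *)

Section SchurComplement.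
Context {R : realType} {H : hilbertType R}.
Variables (B : H -> H) (sB : selfadjoint_op B).
Variables (S : set H) (cS : closed_subspace S).
Implicit Types x y z w : H.

Local Notation P := (proj S).
Local Notation a := (entry_a S B).
Local Notation b := (entry_b S B).
Local Notation r := (sqrt_op (modulus (entry_a S B))).
Local Notation u := (polar (entry_a S B)).
Local Notation f := (reduced_solution r b).

Let bP : bounded_op P := bounded_proj cS.
Let lP : linear P := bounded_lin bP.
Let sP : subspace S := cS.1.
Let PP x : P (P x) = P x. Proof. by apply: proj_id => //; case: (projP x cS). Qed.
Let Psym x y : '<[P x, y]> = '<[x, P y]>. Proof. exact: proj_dot. Qed.
Let bB : bounded_op B. Proof. by case: sB. Qed.
Let lB : linear B. Proof. exact: bounded_lin. Qed.
Let Bsym x y : '<[B x, y]> = '<[x, B y]>.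
Proof. exact: ((selfadjointP B).1 sB).2. Qed.
Let sa : selfadjoint_op a.
Proof. exact: selfadjoint_comp3 (selfadjoint_proj cS) sB. Qed.
Let pr : positive_op r.
Proof. by have [pm _ _ _] := modulusP sa.1; have [] := sqrt_opP pm. Qed.
Let br : bounded_op r. Proof. by case: pr. Qed.
Let lr : linear r. Proof. exact: bounded_lin. Qed.
Let bu : bounded_op u. Proof. by case: (selfadjoint_polar sa). Qed.
Let lu : linear u. Proof. exact: bounded_lin. Qed.
Let usym x y : '<[u x, y]> = '<[x, u y]>.
Proof. exact: ((selfadjointP u).1 (selfadjoint_polar sa)).2. Qed.
Let bE x : b x = P (B (x - P x)).
Proof. by rewrite /entry_b /block /= proj_orthocomp. Qed.
Let bb : bounded_op b.
Proof.
apply: bounded_comp (bounded_comp bP bB) _; apply: bounded_proj.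
exact: orthocomp_closed_subspace.
Qed.

Let u_eq0 x : r x = 0 -> u x = 0.
Proof. by move=> /(sqrt_modulus_eq0 sa)/(polar_eq0 sa). Qed.

Let P_orth x : orthocomp S x <-> P x = 0.
Proof.
split=> [|Px]; first exact: proj_eq0.
by have [_] := projP x cS; rewrite Px subr0.
Qed.

Let P_sub x : P (x - P x) = 0.
Proof. by rewrite linB // PP subrr. Qed.

Let r_orth x : P x = 0 -> r x = 0.
Proof.
move=> Px; apply/(sqrt_modulus_eq0 sa).
by rewrite /entry_a /block /= Px !lin0.
Qed.

Let rP x : r (P x) = r x.
Proof.
by apply/eqP; rewrite eq_sym -subr_eq0 -linB // r_orth.
Qed.

Let Pr x : P (r x) = r x.
Proof. by apply: dot_eq_r => y; rewrite -Psym -!(positive_sym _ _ pr) rP. Qed.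

(** * From weak complementability to a projection *)

Section ReducedSolution.
Hypothesis wc : weakly_complementable S B.

Let fP : [/\ bounded_op f, b = r \o f, nullspace f = nullspace b
    & range f `<=` closure (range r)].
Proof. exact: reduced_solutionP (positive_selfadjoint pr) bb wc. Qed.

Let bf : bounded_op f. Proof. by case: fP. Qed.
Let bf' : bounded_op (adjoint f). Proof. by case: (adjointP bf). Qed.
Let lf' : linear (adjoint f). Proof. exact: bounded_lin. Qed.
Let ff' x y : '<[f x, y]> = '<[x, adjoint f y]>. Proof. by case: (adjointP bf). Qed.
Let rf x : r (f x) = P (B (x - P x)).
Proof. by rewrite -bE; case: fP => _ /(congr1 (@^~ x)). Qed.

(** The nullspace condition on [f] enters here: [b] vanishes on [S], hence so does [f]. Idempotence
    and the nullspace of the projection rest on this. *)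
Lemma proj_adjoint_reduced y : P (adjoint f y) = 0.
Proof.
apply: dot_eq_r => x; rewrite -Psym -ff'.
have -> : f (P x) = 0.
  have [_ _ nf _] := fP; have : nullspace b (P x) by rewrite /nullspace /= bE PP subrr !lin0.
  by rewrite -nf.
by rewrite dot0l dot0r.
Qed.

Lemma adjoint_reduced_sqrt x : adjoint f (r x) = B (P x) - P (B (P x)).
Proof.
apply: dot_eq_r => y.
by rewrite -ff' -(positive_sym _ _ pr) rf Psym Bsym dotBl Psym -dotBr.
Qed.

(** The range condition on [f] enters here: [u u y - y] lies in [N(r)], hence is orthogonal to the
    closure of [R(r)], which contains [f x]. *)
Lemma polar_polar_reduced x : u (u (f x)) = f x.
Proof.
have [_ _ _ fr] := fP; apply/eqP; rewrite -subr_eq0; apply/eqP.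
apply: dot_eq_l => y; rewrite dot0l dotBl !usym -dotBr; apply: dot_eq0C.
apply: (orthocomp_closure _ (fr _ _)); last by exists x.
apply/(orthocomp_range _ (positive_selfadjoint pr)).
by rewrite linB // -!(polar_sqrtC sa) (polar_polar_sqrt sa) subrr.
Qed.

(** Since [a x + b x = P (B x)], this exhibits the element [y] placing [B x] in the domain. *)
Let rvalue x : r (u (r x) + f x) = P (B x).
Proof.
by rewrite linD // -(polar_factor sa) rf /entry_a /block /= -linD // -linD // addrC subrK.
Qed.

(* The domain [R(r) + N(r)] of the projection built from the reduced solution. *)
Definition schur_dom : set H := [set z | exists y, r (z - r y) = 0].

Let schur_choice z : exists y, schur_dom z -> r (z - r y) = 0.
Proof.
have [[y zy]|nz] := pselect (schur_dom z); first by exists y.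
by exists 0.
Qed.

Let g : H -> H := projT1 (choice schur_choice).

Let gP z : schur_dom z -> r (z - r (g z)) = 0.
Proof. exact: projT2 (choice schur_choice) z. Qed.

(** Well-definedness: [r z = r (r y)] fixes [y] up to [N(r)], and [u] vanishes on [N(r)]. *)
Let u_schur z y : r (z - r y) = 0 -> u (g z) = u y.
Proof.
move=> zy; have /gP gz : schur_dom z by exists y.
apply/eqP; rewrite -subr_eq0 -linB //; apply/eqP/u_eq0/dot_self_eq0.
rewrite positive_sym // !linB //.
suff -> : r (r (g z)) - r (r y) = 0 by rewrite dot0r.
move: zy gz; rewrite !linB // => /eqP; rewrite subr_eq0 => /eqP <- /eqP.
by rewrite subr_eq0 => /eqP ->; rewrite subrr.
Qed.

Definition schur_fun z : H := P z + adjoint f (u (g z)).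

Let schur_comb k x y x1 y1 : r (x - r x1) = 0 -> r (y - r y1) = 0 ->
  r (k *: x + y - r (k *: x1 + y1)) = 0.
Proof.
by move=> xx yy; rewrite lr opprD addrACA -scalerBr lr xx yy scaler0 addr0.
Qed.

Lemma schur_dom_subspace : subspace schur_dom.
Proof.
split; first by exists 0; rewrite lin0 // subrr lin0.
by move=> k x y [x1 xx] [y1 yy]; exists (k *: x1 + y1); exact: schur_comb.
Qed.

Lemma schur_fun_linear (k : R[i]) x y : schur_dom x -> schur_dom y ->
  schur_fun (k *: x + y) = k *: schur_fun x + schur_fun y.
Proof.
move=> /gP xx /gP yy; rewrite /schur_fun (u_schur (schur_comb k xx yy)).
by rewrite lP lu lf' scalerDr addrACA.
Qed.

Definition schur_proj : partial_op H :=
  PartialOp schur_dom_subspace schur_fun_linear.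

Let schur_funE z y : r (z - r y) = 0 -> schur_fun z = P z + adjoint f (u y).
Proof. by move=> zy; rewrite /schur_fun (u_schur zy). Qed.

Let r_adjoint x : r (adjoint f x) = 0.
Proof. by rewrite r_orth // proj_adjoint_reduced. Qed.

(** Passing from [z] to its image changes it only by elements of [N(r)], so the same [y] serves for
    both. *)
Let r_schur z y : r (z - r y) = 0 -> r (schur_fun z - r y) = 0.
Proof.
move=> zy; rewrite (schur_funE zy) addrAC (linD _ _ lr) r_adjoint addr0.
by rewrite (linB _ _ lr) rP -(linB _ _ lr).
Qed.

Lemma schur_proj_projection : densely_defined_projection schur_proj.
Proof.
split=> [|_ [z [y zy] <-]|z [y zy]] /=.
- apply/denseP => x; apply: (closure_orthocomp schur_dom_subspace) => y oy.
  suff -> : y = 0 by rewrite dot0r.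
  apply: (orthocomp_range_null (positive_selfadjoint pr)) => z.
    by move=> [w _ <-]; apply: oy; exists w; rewrite subrr lin0.
  by move=> rz; apply: oy; exists 0; rewrite (lin0 lr) subr0.
- by exists y; exact: r_schur.
- rewrite (schur_funE (r_schur zy)) (schur_funE zy) linD // PP.
  by rewrite proj_adjoint_reduced addr0.
Qed.

Lemma pnullspace_schur_proj : pnullspace schur_proj = orthocomp S.
Proof.
apply/seteqP; split=> [z [[y zy] /=]|z /P_orth Pz].
  move=> Ez0; apply/P_orth; have := congr1 P Ez0.
  by rewrite (schur_funE zy) linD // PP proj_adjoint_reduced addr0 lin0.
have z0 : r (z - r 0) = 0 by rewrite (lin0 lr) subr0 r_orth.
split; first by exists 0.
by rewrite /= (schur_funE z0) Pz (lin0 lu) (lin0 lf') addr0.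
Qed.

Lemma schur_proj_sqrt : pcomp_in schur_proj r bounded_op.
Proof.
have h x : r (r x - r x) = 0 by rewrite subrr lin0.
split; first by move=> _ [x _ <-]; exists x.
rewrite (_ : _ \o _ = r \+ (adjoint f \o u)).
  exact: bounded_add br (bounded_comp bf' bu).
by apply/funext => x /=; rewrite (schur_funE (h x)) Pr.
Qed.

Lemma schur_proj_selfadjoint : pcomp_in schur_proj B selfadjoint_op.
Proof.
have h x : r (B x - r (u (r x) + f x)) = 0 by rewrite rvalue r_orth // P_sub.
split; first by move=> _ [x _ <-]; exists (u (r x) + f x).
have Ez x : schur_fun (B x) =
    (P (B x) + (B (P x) - P (B (P x)))) + adjoint f (u (f x)).
  rewrite (schur_funE (h x)) (linD _ _ lu) (linD _ _ lf') addrA.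
  by rewrite (polar_polar_sqrt sa) adjoint_reduced_sqrt.
apply/selfadjointP; split.
  rewrite (_ : _ \o _ = ((P \o B) \+ ((B \o P) \- (P \o B \o P)))
      \+ (adjoint f \o u \o f)); last by apply/funext => x; exact: Ez.
  apply: bounded_add; last exact: bounded_comp (bounded_comp bf' bu) bf.
  apply: bounded_add (bounded_comp bP bB) (bounded_sub (bounded_comp bB bP) _).
  exact: bounded_comp (bounded_comp bP bB) bP.
move=> x y /=; rewrite !Ez !dotDl !dotDr !dotNl !dotNr; congr (_ + _).
  by rewrite !Psym !Bsym !Psym addrCA.
by rewrite dotC -ff' -usym -dotC ff'.
Qed.

End ReducedSolution.

(** * From an admissible projection to the Schur complement *)

Section Admissible.
Variable E : partial_op H.
Hypotheses (pE : densely_defined_projection E)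
  (nE : pnullspace E = orthocomp S)
  (rE : pcomp_in E r bounded_op) (BE : pcomp_in E B selfadjoint_op).

Let T : H -> H := E \o r.

Let E_sub x y : pdom E x -> pdom E y -> E (x - y) = E x - E y.
Proof.
move=> Ex Ey; have := pfun_linear (-1) Ey Ex.
by rewrite !scaleN1r addrC => ->; rewrite addrC.
Qed.

Let orth_dom x : P x = 0 -> pdom E x /\ E x = 0.
Proof. by move=> /P_orth; rewrite -nE. Qed.

Let proj_dom x : pdom E x -> pdom E (P x) /\ E (P x) = E x.
Proof.
move=> Ex; have [dx Ex0] := orth_dom (P_sub x).
have -> : P x = x - (x - P x) by rewrite opprB addrC subrK.
split; first exact: subspaceB (pdom_subspace E) Ex dx.
by rewrite E_sub // Ex0 subr0.
Qed.

(** The vector [x - E x] is in the nullspace of [E], which is the complement of [S]. *)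
Let PE x : pdom E x -> P (E x) = P x.
Proof.
move=> Ex; have [_ Edom EE] := pE.
have Exd : pdom E (E x) by apply: Edom; exists x.
have : pnullspace E (x - E x).
  split; first exact: subspaceB (pdom_subspace E) Ex Exd.
  by rewrite E_sub // EE // subrr.
by rewrite nE => /P_orth; rewrite linB // => /eqP; rewrite subr_eq0 => /eqP.
Qed.

Let domB x : pdom E (B x). Proof. by apply: BE.1; exists x. Qed.
Let domr x : pdom E (r x). Proof. by apply: rE.1; exists x. Qed.

Let EBP x : E (B (P x)) = B (P x).
Proof.
have EBsym := ((selfadjointP _).1 BE.2).2.
apply: dot_eq_r => y; rewrite -[LHS](EBsym y (P x)) /= -Psym PE //.
by rewrite Psym Bsym.
Qed.

Let BP x : B (P x) = T (u (r x)).
Proof.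
by rewrite -EBP -(proj_dom (domB _)).2 /T /= -(polar_factor sa).
Qed.

Lemma admissible_weakly_complementable : weakly_complementable S B.
Proof.
have bT : bounded_op T := rE.2.
have [_ TT'] := adjointP bT.
(* The adjoint of [B P = T u r] is [P B = r u (adjoint T)], which supplies the preimage of [b x]
   under [r]. *)
move=> _ [x _ <-]; exists (u (adjoint T (x - P x))) => //.
apply: dot_eq_r => y; rewrite bE -Psym -Bsym BP.
by rewrite -(positive_sym _ _ pr) -usym -TT'.
Qed.

Lemma admissible_schur_complement : weakly_complementable S B ->
  schur_complement S B = B \- (E \o B).
Proof.
move=> wc; have bT : bounded_op T := rE.2.
have [bf rfE _ fr] := reduced_solutionP (positive_selfadjoint pr) bb wc.
have [bf' ff'] := adjointP bf.
have sr := positive_selfadjoint pr.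
have PT x : P (T x) = r x by rewrite /T /= PE // Pr.
have f'u : adjoint f = (T \- r) \o u.
  (* On [R(r)] the two sides agree by [B P - P B P = (T - P T) u r] and [P T = r]; on [N(r)] the
     right side vanishes with [u], the left because [R(f)] is orthogonal to [N(r)]. *)
  apply: (eq_on_range_null sr) => //.
  - exact: bounded_comp (bounded_sub bT br) bu.
  - by move=> x; rewrite adjoint_reduced_sqrt // BP /= PT.
  - move=> x rx; have -> : ((T \- r) \o u) x = 0.
      by rewrite /= (u_eq0 rx) (lin0 (bounded_lin bT)) (lin0 lr) subrr.
    apply: dot_eq_r => y; rewrite dot0r -ff'; apply: dot_eq0C.
    apply: (orthocomp_closure _ (fr _ _)); last by exists y.
    exact/(orthocomp_range _ sr).
apply/funext => x; rewrite /schur_complement /= {1}f'u /= polar_polar_reduced //.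
have rfx : r (f x) = b x by rewrite [in RHS]rfE.
rewrite rfx /T /= rfx /entry_c /block /= !proj_orthocomp // bE.
(* It remains to combine [b + c = B (I - P)] with [E b = E B (I - P) = E B - B P]; the terms [B P]
   cancel. *)
have QB : E (P (B (x - P x))) = E (B (x - P x)) by rewrite (proj_dom (domB _)).2.
rewrite QB opprB addrA subrK.
by rewrite linB // E_sub // EBP opprB addrA subrK.
Qed.

End Admissible.

End SchurComplement.

Theorem theorem3p14 (R : realType) (H : hilbertType R) (H_separable : separable H)
    (B : H -> H) (B_selfadjoint : selfadjoint_op B)
    (S : set H) (S_closed : closed_subspace S) :
  let admissible (E : partial_op H) :=
    [/\ densely_defined_projection E,
        pnullspace E = orthocomp S,
        pcomp_in E (sqrt_op (modulus (proj S \o B \o proj S))) bounded_op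
      & pcomp_in E B selfadjoint_op] in
  (weakly_complementable S B <-> exists E : partial_op H, admissible E) /\
  (weakly_complementable S B -> forall E : partial_op H, admissible E ->
     schur_complement S B = B \- (E \o B)).
Proof.
move=> admissible; split; last first.
  by move=> wc E [pE nE rE BE]; apply: admissible_schur_complement.
split=> [wc|[E [pE nE rE BE]]]; last exact: (admissible_weakly_complementable _ _ pE).
exists (schur_proj B_selfadjoint S_closed wc); split.
- exact: schur_proj_projection.
- exact: pnullspace_schur_proj.
- exact: schur_proj_sqrt.
- exact: schur_proj_selfadjoint.
Qed.
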